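(* Let $p\in(0,\infty)\setminus\mathbb{N}$, $\ell:=\lceil p-1\rceil$, and let $X$ be a real random variable with $\mathsf{E}\, X_+^p<\infty$. Then the following two conditions are equivalent: (I) $\mathsf{E}|X|^\ell<\infty$ and \[ \mathsf{E}\, X_+^p=\frac{\Gamma(p+1)}{\pi}\int_{0+}^\infty\operatorname{Re}\frac{\mathsf{E}\, e_\ell(itX)}{(it)^{p+1}}\,dt, \] where $\int_{0+}^\infty$ denotes $\lim_{v\downarrow0}\int_v^\infty$ (the integrals over $[v,\infty)$ taken in the Lebesgue sense); (II) $\mathsf{P}(X_->x)=o(x^{-p})$ as $x\to\infty$.
   Context: $x_+:=\max(0,x)$, $x_-:=\max(0,-x)$, $x_+^p:=(x_+)^p$. For complex $z$, $e_\ell(z):=e^z-\sum_{j=0}^\ell z^j/j!$. For $t>0$, $(it)^{p+1}:=t^{p+1}e^{i\pi(p+1)/2}$ (principal branch). *)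

(* Defs.v *)
From HB Require Import structures.
From mathcomp Require Import all_boot all_order all_algebra.
From mathcomp Require Import all_classical all_reals all_analysis.
From mathcomp Require Import complex.
Set Implicit Arguments. Unset Strict Implicit. Unset Printing Implicit Defensive.
Import Order.TTheory GRing.Theory Num.Theory.
Import numFieldNormedType.Exports.
Local Open Scope classical_set_scope.
Local Open Scope ring_scope.
Local Open Scope complex_scope.

Section defs.
Variable R : realType.

Definition cexp (z : R[i]) : R[i] :=
  (expR (complex.Re z))%:C * (cos (complex.Im z) +i* sin (complex.Im z)).

Definition e_ell (l : nat) (z : R[i]) : R[i] :=
  cexp z - \sum_(j < l.+1) z ^+ j / (j`!)%:R.

(* (it)^q := t^q e^{i pi q / 2}, for t > 0 (principal branch) *)
Definition itpow (t q : R) : R[i] :=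
  (t `^ q)%:C * cexp (0 +i* (pi * q / 2)).

Definition Gamma (s : R) : R :=
  Rintegral lebesgue_measure `]0, +oo[ (fun t => t `^ (s - 1) * expR (- t)).

(* l := ceil(p - 1), as a natural number (p > 0 so ceil(p-1) >= 0) *)
Definition ell (p : R) : nat := `|Num.ceil (p - 1)|%N.
End defs.

Definition cexpect d (T : measurableType d) (R : realType)
  (P : probability T R) (f : T -> R[i]) : R[i] :=
  (fine 'E_P[fun w => complex.Re (f w)]) +i* (fine 'E_P[fun w => complex.Im (f w)]).

Definition integrand d (T : measurableType d) (R : realType)
  (P : probability T R) (X : T -> R) (p : R) (t : R) : R :=
  complex.Re (cexpect P (fun w => e_ell (ell p) (0 +i* (t * X w))) / itpow t (p + 1)).

(* Main.v *)
(* Put n = ell p, phi = pi (p + 1) / 2, and let T_f be the Taylor remainder of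
   order n + 1 at 0 of u |-> cos (u + f). Then Re (e_n (i x) / (i t)^(p+1)) is
   T_{-phi}(x) t^-(p+1), and T_f(- u) = T_{-f}(u), so that after exchanging the
   integrals the integral over [v, oo) of the integrand becomes
     E X_+^p A_{-phi}(v X_+) + v^-p E B(v X_-),
   where A_f(Y) is the integral over ]Y, oo[ of T_f(u) u^-(p+1) and
   B(y) = y^p A_phi(y). Laplace transforms and the integral of s^a / (1 + s^2)
   over ]0, oo[, equal to pi / (2 cos (pi a / 2)), give
   Gamma(p + 1) A_{-phi}(0) = pi and A_phi(0) = 0. By dominated convergence the
   first term yields E X_+^p in the limit, hence (I) means E B(v X_-) = o(v^p).
   Now (-1)^n B is nonnegative and bounded below by a positive constant near
   infinity, so (I) implies (II) as in Markov's inequality; conversely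
   |B(y)| <= C min(y^n, y^(n+1)), and E min((v X_-)^n, (v X_-)^(n+1)) is o(v^p)
   under (II) by the layer cake formula. *)

(* Under (II) the p-th moment of X_- may be infinite, so the negative part admits no dominated
   convergence. For E |X|^n < oo the cut at v makes Fubini legitimate, and the negative part is then
   carried by the one kernel B. Its two bounds have exponents on either side of p, which is what
   turns a tail o(x^-p) into o(v^p): y^n comes from integrating over ]y, oo[, and y^(n+1) from
   A_phi(0) = 0, which replaces that domain by ]0, y]. The values at 0 come from a single
   computation. With q = p - n in ]0, 1[, the Laplace transform leaves the integrals of s^q / (1 +
   s^2) and s^(q-1) / (1 + s^2), weighted by the cosine and the sine of an angle congruent to -q pi
   / 2 or q pi / 2 modulo pi. Both products are pi / 2 up to sign: they add for the phase -phi and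
   cancel for phi. The sign of B is not visible on an oscillating integral whose value over the
   whole half-line is 0. Lowering n and p together by differentiation leaves the case n = 0, where
   periodicity of [tcos 1 phi] decides. *)
Require Import Defs.
From HB Require Import structures.
From mathcomp Require Import all_boot all_order all_algebra.
From mathcomp Require Import all_classical all_reals all_analysis.
From mathcomp Require Import complex measurable_realfun.
From mathcomp Require Import ring lra.

Set Implicit Arguments. Unset Strict Implicit. Unset Printing Implicit Defensive.
Import Order.TTheory GRing.Theory Num.Theory.
Import numFieldNormedType.Exports.
Local Open Scope classical_set_scope.
Local Open Scope ring_scope.

(** * Convergence along exhausting sets and the fundamental theorem of calculus on half-lines *)

Section integration_tools.
Context {R : realType}.
Notation mu := (@lebesgue_measure R).

Lemma integrable_le_abs d (T : measurableType d) (m : {measure set T -> \bar R})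
    (D : set T) (f g : T -> R) : measurable D -> measurable_fun D f ->
  (forall x, D x -> `|f x| <= g x) -> m.-integrable D (EFin \o g) ->
  m.-integrable D (EFin \o f).
Proof.
move=> mD mf fg ig; apply: le_integrable ig => //.
  exact/measurable_EFinP.
move=> x Dx /=; rewrite lee_fin (le_trans (fg _ Dx))// ?ler_norm//.
Qed.

(** Dominated convergence with |f| as the bound. The sets [D_ k] need not increase, so that it
    covers exhaustion by segments as well as half-lines []u k, +oo[] for an arbitrary sequence [u]
    tending to 0. *)
Lemma Rintegral_set_cvg d (T : measurableType d) (m : {measure set T -> \bar R})
    (D : set T) (D_ : (set T)^nat) (f : T -> R) :
  measurable D -> (forall k, measurable (D_ k)) -> (forall k, D_ k `<=` D) ->
  (forall x, D x -> \forall k \near \oo, D_ k x) ->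
  m.-integrable D (EFin \o f) ->
  Rintegral m (D_ k) f @[k --> \oo] --> Rintegral m D f.
Proof.
move=> mD mD_ D_D D_x intf.
have mf : measurable_fun D f.
  by apply/measurable_EFinP; case/integrableP: intf.
have E k : Rintegral m (D_ k) f = fine (\int[m]_(x in D) ((f \_ (D_ k)) x)%:E)%E.
  by rewrite -[in LHS](setIidr (D_D k)) Rintegral_mkcondr.
have [] := @dominated_convergence _ _ _ m D mD
   (fun k x => ((f \_ (D_ k)) x)%:E) (EFin \o f) (fun x => `|f x|%:E).
- move=> k; apply/measurable_EFinP; apply/(measurable_restrict f) => //.
  by rewrite setIidr//; apply: measurable_funS mf => //.
- by apply/measurable_EFinP.
- apply/aeW => x Dx; apply: cvg_near_cst.
  by have := D_x x Dx; apply: filterS => k Dkx; rewrite patchE mem_set.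
- exact: integrable_abse intf.
- apply/aeW => x k Dx; rewrite lee_fin patchE; case: ifP => // _.
  by rewrite normr0.
move=> _ _ c; under eq_fun do rewrite E.
apply: fine_cvg; rewrite /Rintegral fineK//.
exact: integrable_fin_num.
Qed.

Lemma Rintegral_FTC_segment (f F : R -> R) (a b : R) : a < b ->
  (forall x, a <= x <= b -> {for x, continuous f}) ->
  (forall x, a <= x <= b -> is_derive x 1 F (f x)) ->
  (\int[mu]_(x in `[a, b]) (f x)%:E = (F b - F a)%:E)%E.
Proof.
move=> ab cf dF; rewrite EFinB; apply: continuous_FTC2 => //.
- apply: continuous_in_subspaceT => x /set_mem /=.
  by rewrite in_itv/=; apply: cf.
- have cF x : a <= x <= b -> {for x, continuous F}.
    by move=> /dF xF; apply/differentiable_continuous/derivable1_diffP.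
  split.
  + move=> x; rewrite in_itv/= => /andP[ax xb].
    by have := dF x; rewrite (ltW ax) (ltW xb) => /(_ isT) [].
  + by apply: cvg_at_right_filter; apply: cF; rewrite lexx ltW.
  + by apply: cvg_at_left_filter; apply: cF; rewrite lexx ltW.
- move=> x; rewrite in_itv/= => /andP[ax xb].
  have := dF x; rewrite (ltW ax) (ltW xb) => /(_ isT) [_ <-].
  by rewrite derive1E.
Qed.

Lemma measurable_fun_cont_oy (f : R -> R) (a : R) :
  (forall x, a < x -> {for x, continuous f}) -> measurable_fun `]a, +oo[ f.
Proof.
move=> cf; apply: open_continuous_measurable_fun => //.
move=> x /set_mem /=; rewrite in_itv/= andbT; exact: cf.
Qed.

Lemma cvg_itvoy_inner (a : R) (x : R) : a < x ->
  \forall k \near \oo, `[a + k.+1%:R^-1, a + 1 + k%:R]%classic x.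
Proof.
move=> ax; near=> k; rewrite /= in_itv/=; apply/andP; split.
  rewrite -lerBrDl; apply/ltW; near: k.
  have e0 : 0 < x - a by rewrite subr_gt0.
  exact: (near_infty_natSinv_lt (PosNum e0)).
rewrite -lerBlDl; near: k; exact: nbhs_infty_ger.
Unshelve. all: end_near. Qed.

Section exhaustion.
Variables (f F : R -> R) (D : set R) (a_ b_ : nat -> R) (la ly : R).
Hypothesis mD : measurable D.
Hypothesis UD : D = \bigcup_k `[a_ k, b_ k]%classic.
Hypothesis ab : forall k, a_ k <= b_ k.
Hypothesis aS : forall k, a_ k.+1 <= a_ k.
Hypothesis bS : forall k, b_ k <= b_ k.+1.
Hypothesis cf : forall x, D x -> {for x, continuous f}.
Hypothesis dF : forall x, D x -> is_derive x 1 F (f x).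
Hypothesis Fa : F (a_ k) @[k --> \oo] --> la.
Hypothesis Fb : F (b_ k) @[k --> \oo] --> ly.

Let D_ k := `[a_ k, b_ k]%classic.

Let sub k : D_ k `<=` D.
Proof. by move=> x ?; rewrite UD; exists k. Qed.

Let nd : nondecreasing_seq D_.
Proof.
apply/nondecreasing_seqP => n; apply/subsetPset => x.
rewrite /D_ /= !in_itv/= => /andP[ax xa]; apply/andP; split.
  exact: le_trans ax.
exact: le_trans xa _.
Qed.

Let mf : measurable_fun D f.
Proof.
rewrite UD; apply/measurable_fun_bigcup => // k.
apply: subspace_continuous_measurable_fun => //.
apply: continuous_in_subspaceT => x /set_mem xD; apply: cf; exact: sub xD.
Qed.

Let E k : (\int[mu]_(x in D_ k) (f x)%:E = (F (b_ k) - F (a_ k))%:E)%E.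
Proof.
have := ab k; rewrite le_eqVlt => /predU1P[e|lt1].
  by rewrite /D_ e set_itv1 integral_set1 subrr.
apply: Rintegral_FTC_segment => // x xD; [apply: cf|apply: dF];
by apply: (@sub k); rewrite /D_ /= in_itv.
Qed.

(** The segments exhaust domains such as []a, +oo[] and []0, c]], so [F] only needs limits at the
    ends. Integrability is assumed because [f] may oscillate. *)
Lemma Rintegral_FTC_exhaust : mu.-integrable D (EFin \o f) ->
  Rintegral mu D f = ly - la.
Proof.
move=> intf.
have c1 : Rintegral mu (D_ k) f @[k --> \oo] --> Rintegral mu D f.
  apply: Rintegral_set_cvg => // [k|x]; first exact: measurable_itv.
  rewrite UD => -[N _ xN]; exists N => // k /= Nk.
  by move/subsetPset : (nd Nk); exact.
have c2 : Rintegral mu (D_ k) f @[k --> \oo] --> ly - la.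
  by rewrite /Rintegral; under eq_fun do rewrite E; exact: cvgB.
exact: cvg_unique c1 c2.
Qed.

(** For nonnegative [f], monotone convergence identifies the integral with the limit of the
    increments of [F], which is finite. *)
Lemma integrable_ge0_FTC_exhaust : (forall x, D x -> 0 <= f x) ->
  mu.-integrable D (EFin \o f).
Proof.
move=> f0.
have c1 : (\int[mu]_(x in D_ k) (f x)%:E @[k --> \oo] -->
   \int[mu]_(x in D) (f x)%:E)%E.
  rewrite UD; apply: ge0_nondecreasing_set_cvg_integral => //.
  - by move=> i; exact: measurable_itv.
  - by move=> i; apply/measurable_EFinP; apply: measurable_funS mf.
  - by move=> i x /sub /f0; rewrite lee_fin.
have c2 : (\int[mu]_(x in D_ k) (f x)%:E @[k --> \oo] --> (ly - la)%:E)%E.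
  under eq_fun do rewrite E.
  by apply: cvg_EFin; [exact: nearW|exact: cvgB].
apply/integrableP; split; first exact/measurable_EFinP.
have -> : (\int[mu]_(x in D) `|(EFin \o f) x| = \int[mu]_(x in D) (f x)%:E)%E.
  by apply: eq_integral => x /set_mem /= xD; rewrite ger0_norm// f0.
by rewrite (cvg_unique _ c1 c2)// ltry.
Qed.

End exhaustion.

Let seqA (a : R) k := a + k.+1%:R^-1.

(** The offset 1 gives [seqA a k <= seqB a k] for every [k]; the segment of index 0 is a point. *)
Let seqB (a : R) k := a + 1 + k%:R.

Let itvoyE (a : R) : `]a, +oo[%classic = \bigcup_k `[seqA a k, seqB a k]%classic.
Proof.
apply/seteqP; split=> x /=; rewrite in_itv/= andbT.
  by move=> /cvg_itvoy_inner[N _ /(_ N (leqnn N))] ?; exists N.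
case=> k _ /=; rewrite in_itv/= => /andP[ax _].
by rewrite (lt_le_trans _ ax)// ltrDl invr_gt0 ltr0n.
Qed.

Let seqAB a k : seqA a k <= seqB a k.
Proof.
rewrite /seqB -addrA lerD2l (@le_trans _ _ 1) ?lerDl ?ler0n//.
by rewrite invf_le1 ?ltr0n// ler1n.
Qed.

Let seqAS a k : seqA a k.+1 <= seqA a k.
Proof. by rewrite lerD2l lef_pV2 ?posrE ?ltr0n// ler_nat. Qed.

Let seqBS a k : seqB a k <= seqB a k.+1.
Proof. by rewrite lerD2l ler_nat. Qed.

Let cvg_seqA (F : R -> R) (a l : R) : F x @[x --> a^'+] --> l ->
  F (seqA a k) @[k --> \oo] --> l.
Proof.
move=> /cvg_at_rightP; apply; split=> [n|].
  by rewrite ltrDl invr_gt0 ltr0n.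
rewrite -[X in _ --> X]addr0; apply: cvgD; first exact: cvg_cst.
exact: cvg_harmonic.
Qed.

Let cvg_seqB (F : R -> R) (a l : R) : F x @[x --> +oo] --> l ->
  F (seqB a k) @[k --> \oo] --> l.
Proof.
move=> Fy; apply: (cvg_comp (seqB a) F _ Fy).
by apply/cvgryPge => A; near=> k; rewrite -lerBlDl; near: k; exact: nbhs_infty_ger.
Unshelve. all: end_near. Qed.

Lemma Rintegral_FTCoy (f F : R -> R) (a la ly : R) :
  (forall x, a < x -> {for x, continuous f}) ->
  (forall x, a < x -> is_derive x 1 F (f x)) ->
  F x @[x --> a^'+] --> la -> F x @[x --> +oo] --> ly ->
  mu.-integrable `]a, +oo[ (EFin \o f) ->
  \int[mu]_(x in `]a, +oo[) f x = ly - la.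
Proof.
move=> cf dF Fa Fy; apply: (Rintegral_FTC_exhaust (F := F)
  (a_ := seqA a) (b_ := seqB a)) => //.
- by move=> x /=; rewrite in_itv/= andbT; exact: cf.
- by move=> x /=; rewrite in_itv/= andbT; exact: dF.
- exact: cvg_seqA.
- exact: cvg_seqB.
Qed.

Lemma integrable_ge0_FTCoy (f F : R -> R) (a la ly : R) :
  (forall x, a < x -> 0 <= f x) ->
  (forall x, a < x -> {for x, continuous f}) ->
  (forall x, a < x -> is_derive x 1 F (f x)) ->
  F x @[x --> a^'+] --> la -> F x @[x --> +oo] --> ly ->
  mu.-integrable `]a, +oo[ (EFin \o f).
Proof.
move=> f0 cf dF Fa Fy; apply: (integrable_ge0_FTC_exhaust (F := F)
  (a_ := seqA a) (b_ := seqB a) (la := la) (ly := ly)) => //.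
- by move=> x /=; rewrite in_itv/= andbT; exact: cf.
- by move=> x /=; rewrite in_itv/= andbT; exact: dF.
- exact: cvg_seqA.
- exact: cvg_seqB.
- by move=> x; rewrite /= in_itv/= andbT; exact: f0.
Qed.

End integration_tools.

(** * Integrals of powers near 0 and near infinity *)

Section power_integrals.
Context {R : realType}.
Notation mu := (@lebesgue_measure R).

Lemma powR_cvgy0 (r : R) : r < 0 -> x `^ r @[x --> +oo] --> (0 : R).
Proof.
move=> r0; apply/cvgrPdist_le => e e0; near=> x.
have x0 : 0 < x by near: x; apply: nbhs_pinfty_gt; exact: num_real.
rewrite sub0r normrN ger0_norm ?powR_ge0//; apply/ltW.
(* Writing e as the r-th power of e^(1/r) makes e^(1/r) the threshold for [x]. *)
rewrite -[e]powRr1 ?ltW// -[X in e `^ X](@mulVf _ r) ?lt_eqF// powRrM.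
rewrite -[r in X in X < _]opprK -[X in _ < _ `^ X]opprK [ltLHS]powRN [ltRHS]powRN.
rewrite ltf_pV2 ?posrE ?powR_gt0//.
apply: gt0_ltr_powR; rewrite ?nnegrE ?powR_ge0 ?oppr_gt0 ?ltW//.
Unshelve. all: end_near. Qed.

Lemma continuous_powR (r x : R) : 0 < x -> {for x, continuous (@powR R ^~ r)}.
Proof.
by move=> x0; apply/differentiable_continuous/derivable1_diffP/derivable_powR;
  rewrite in_itv/= andbT.
Qed.

Lemma is_derive_powR_primitive (r x : R) : r != -1 -> 0 < x ->
  is_derive x 1 (fun y => y `^ (r + 1) / (r + 1)) (x `^ r).
Proof.
move=> r1 x0; have dp := is_derive1_powR (r + 1) x0.
have r10 : r + 1 != 0 by rewrite addr_eq0.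
rewrite (_ : (fun y => _) = (r + 1)^-1 *: (@powR R ^~ (r + 1))); last first.
  by apply/funext => y; rewrite /GRing.scale/= mulrC.
have -> : x `^ r = (r + 1)^-1 *: ((r + 1) * x `^ (r + 1 - 1)).
  by rewrite /GRing.scale/= mulKf// addrK.
exact: is_deriveZ.
Qed.

Lemma integrable_powR_oy (a r : R) : 0 < a -> r < -1 ->
  mu.-integrable `]a, +oo[ (EFin \o @powR R ^~ r).
Proof.
move=> a0 r1; have rn : r + 1 < 0 by rewrite -ltrBrDr sub0r.
apply: (integrable_ge0_FTCoy (F := fun y => y `^ (r + 1) / (r + 1))
  (la := a `^ (r + 1) / (r + 1)) (ly := 0 / (r + 1))).
- by move=> x _; exact: powR_ge0.
- by move=> x ax; apply: continuous_powR; exact: lt_trans ax.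
- by move=> x ax; apply: is_derive_powR_primitive; [rewrite lt_eqF|exact: lt_trans ax].
- apply: cvgM; last exact: cvg_cst.
  by apply: cvg_at_right_filter; exact: continuous_powR.
- by apply: cvgM; [exact: powR_cvgy0|exact: cvg_cst].
Qed.

Lemma Rintegral_powR_oy (a r : R) : 0 < a -> r < -1 ->
  \int[mu]_(x in `]a, +oo[) x `^ r = a `^ (r + 1) / - (r + 1).
Proof.
move=> a0 r1; have rn : r + 1 < 0 by rewrite -ltrBrDr sub0r.
have -> : a `^ (r + 1) / - (r + 1) = 0 / (r + 1) - a `^ (r + 1) / (r + 1).
  by rewrite mul0r sub0r invrN mulrN.
apply: (@Rintegral_FTCoy _ _ (fun y => y `^ (r + 1) / (r + 1))).
- by move=> x ax; apply: continuous_powR; exact: lt_trans ax.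
- by move=> x ax; apply: is_derive_powR_primitive; [rewrite lt_eqF|exact: lt_trans ax].
- apply: cvgM; last exact: cvg_cst.
  by apply: cvg_at_right_filter; exact: continuous_powR.
- by apply: cvgM; [exact: powR_cvgy0|exact: cvg_cst].
- exact: integrable_powR_oy.
Qed.

Section powR_near0.
Variables (c r : R).
Hypotheses (c0 : 0 < c) (r1 : -1 < r).

Let rp : 0 < r + 1. Proof. by rewrite -ltrBlDr sub0r. Qed.

Let A k := c / k.+1%:R.

Let UD : `]0, c]%classic = \bigcup_k `[A k, c]%classic.
Proof.
apply/seteqP; split=> x /=; rewrite in_itv/=.
  move=> /andP[x0 xc]; have e0 : 0 < x / c by rewrite divr_gt0.
  have [N _ /(_ N (leqnn N))] := near_infty_natSinv_lt (PosNum e0).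
  rewrite /= ltr_pdivlMr// mulrC => xN; exists N => //=.
  by rewrite in_itv/= xc andbT ltW.
case=> k _ /=; rewrite in_itv/= => /andP[ax ->]; rewrite andbT.
by rewrite (lt_le_trans _ ax)// divr_gt0.
Qed.

Let cvgA : (A k) `^ (r + 1) / (r + 1) @[k --> \oo] --> 0 / (r + 1).
Proof.
apply: cvgM; last exact: cvg_cst.
have /cvg_at_rightP := powR_cvg0 rp; apply; split=> [n|].
  by rewrite divr_gt0.
rewrite -[X in _ --> X](mulr0 c); apply: cvgM; first exact: cvg_cst.
exact: cvg_harmonic.
Qed.

Let Ac k : A k <= c.
Proof. by rewrite /A ler_pdivrMr// ler_peMr ?ler1n// ltW. Qed.

Let AS k : A k.+1 <= A k.
Proof. by rewrite /A ler_wpM2l ?(ltW c0)// lef_pV2 ?posrE ?ltr0n// ler_nat. Qed.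

Lemma integrable_powR_0c : mu.-integrable `]0, c] (EFin \o @powR R ^~ r).
Proof.
apply: (integrable_ge0_FTC_exhaust (F := fun y => y `^ (r + 1) / (r + 1))
  (a_ := A) (b_ := fun=> c) (la := 0 / (r + 1))) => //.
- by move=> x /=; rewrite in_itv/= => /andP[x0 _]; exact: continuous_powR.
- move=> x /=; rewrite in_itv/= => /andP[x0 _]; apply: is_derive_powR_primitive => //.
  by rewrite gt_eqF.
- exact: cvg_cst.
- by move=> x _; exact: powR_ge0.
Qed.

Lemma Rintegral_powR_0c : \int[mu]_(x in `]0, c]) x `^ r = c `^ (r + 1) / (r + 1).
Proof.
have -> : c `^ (r + 1) / (r + 1) = c `^ (r + 1) / (r + 1) - 0 / (r + 1).
  by rewrite mul0r subr0.
apply: (Rintegral_FTC_exhaust (F := fun y => y `^ (r + 1) / (r + 1))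
  (a_ := A) (b_ := fun=> c)) => //.
- by move=> x /=; rewrite in_itv/= => /andP[x0 _]; exact: continuous_powR.
- move=> x /=; rewrite in_itv/= => /andP[x0 _]; apply: is_derive_powR_primitive => //.
  by rewrite gt_eqF.
- exact: cvg_cst.
- exact: integrable_powR_0c.
Qed.

End powR_near0.

End power_integrals.

(** * Linear change of variable and exchange of integrals *)

Section scaling_and_Fubini.
Context {R : realType}.
Notation mu := (@lebesgue_measure R).

Let measurable_fun_scale (f : R -> R) (a c : R) : 0 < c ->
  {within `[c * a, +oo[, continuous f} ->
  measurable_fun `]a, +oo[ (fun x => f (c * x)).
Proof.
move=> c0 cf; apply: measurable_fun_cont_oy => x ax.
apply: continuous_comp; first by apply: cvgM; [exact: cvg_cst|exact: cvg_id].
by move/continuous_within_itvcyP : cf => [+ _]; apply; rewrite in_itv/= andbT ltr_pM2l.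
Qed.

Lemma ge0_integral_scale (f : R -> R) (a c : R) : 0 < c ->
  {within `[c * a, +oo[, continuous f} -> (forall x, c * a < x -> 0 <= f x) ->
  (\int[mu]_(x in `](c * a)%R, +oo[) (f x)%:E =
   c%:E * \int[mu]_(x in `]a, +oo[) (f (c * x)%R)%:E)%E.
Proof.
move=> c0 cf f0.
have dF (x : R) : is_derive x 1 (fun y : R => c * y) c.
  have := is_deriveZ c (is_derive_id x (1 : R)).
  by rewrite /GRing.scale/= mulr1.
have F' : derive1 (fun y : R => c * y) = cst c.
  by apply/funext => x; rewrite derive1E; case: (dF x).
have mf : measurable_fun `]c * a, +oo[ f.
  apply: measurable_fun_cont_oy.
  by move/continuous_within_itvcyP : cf => [cf _] x xa; apply: cf; rewrite in_itv/= xa.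
have mfc := measurable_fun_scale c0 cf.
rewrite [LHS]integral_itv_obnd_cbnd; last exact/measurable_EFinP.
pose F := fun y : R => c * y.
rewrite [LHS](_ : _ = \int[mu]_(x in `[a, +oo[) (((f \o F) * derive1 F) x)%:E)%E; last first.
apply: (@increasing_ge0_integration_by_substitutiony _ F f a).
- by move=> x y _ _ xy; rewrite ltr_pM2l.
- by rewrite F' => x _; exact: cvg_cst.
- by rewrite F'; exact: is_cvg_cst.
- by rewrite F'; exact: is_cvg_cst.
- split; first by move=> x _; case: (dF x).
  by apply: cvg_at_right_filter; apply: cvgM; [exact: cvg_cst|exact: cvg_id].
- by apply: gt0_cvgMry => //; exact: cvg_cst.
- by [].
- by move=> x; rewrite in_itv/= andbT => /f0.
rewrite -[LHS]integral_itv_obnd_cbnd; last first.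
  by rewrite F'; apply/measurable_EFinP; apply: measurable_funM.
rewrite -ge0_integralZl//=; last 3 first.
- exact/measurable_EFinP.
- by move=> x; rewrite in_itv/= andbT => ax; rewrite lee_fin f0// ltr_pM2l.
- exact: ltW.
by rewrite F'; apply: eq_integral => x _; rewrite -EFinM mulrC.
Qed.

Lemma integrable_scale (f : R -> R) (a c : R) : 0 < c ->
  {within `[c * a, +oo[, continuous f} ->
  mu.-integrable `]c * a, +oo[ (EFin \o f) ->
  mu.-integrable `]a, +oo[ (EFin \o (fun x => f (c * x))).
Proof.
move=> c0 cf /integrableP[mf intf].
have cnf : {within `[c * a, +oo[, continuous (fun x => `|f x|)}.
  by move=> x; apply: continuous_comp; [exact: cf|exact: norm_continuous].
apply/integrableP; split.
  by apply/measurable_EFinP; exact: measurable_fun_scale cf.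
have := @ge0_integral_scale _ a c c0 cnf (fun x _ => normr_ge0 _).
rewrite /= in intf *; move=> E; rewrite E in intf.
move: intf; rewrite !ltey; apply: contra => /eqP ->.
by rewrite gt0_muley// lte_fin.
Qed.

(** The nonnegative case applies to both terms of f = (f + |f|) - |f|, which are continuous along
    with f. *)
Lemma Rintegral_scale (f : R -> R) (a c : R) : 0 < c ->
  {within `[c * a, +oo[, continuous f} ->
  mu.-integrable `]c * a, +oo[ (EFin \o f) ->
  \int[mu]_(x in `]c * a, +oo[) f x = c * \int[mu]_(x in `]a, +oo[) f (c * x).
Proof.
move=> c0 cf intf.
have cnf : {within `[c * a, +oo[, continuous (fun x => `|f x|)}.
  by move=> x; apply: continuous_comp; [exact: cf|exact: norm_continuous].
have csf : {within `[c * a, +oo[, continuous (fun x => f x + `|f x|)}.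
  by move=> x; apply: cvgD; [exact: cf|exact: cnf].
have infn : mu.-integrable `]c * a, +oo[ (EFin \o (fun x => `|f x|)).
  exact: integrable_abse intf.
have infs : mu.-integrable `]c * a, +oo[ (EFin \o (fun x => f x + `|f x|)).
  exact: (integrableD _ intf infn).
have E0 (g : R -> R) : {within `[c * a, +oo[, continuous g} ->
    mu.-integrable `]c * a, +oo[ (EFin \o g) -> (forall x, 0 <= g x) ->
    \int[mu]_(x in `]c * a, +oo[) g x = c * \int[mu]_(x in `]a, +oo[) g (c * x).
  move=> cg ig g0; rewrite /Rintegral ge0_integral_scale// fineM//.
  by apply: integrable_fin_num => //; exact: (integrable_scale c0 cg ig).
have -> : \int[mu]_(x in `]c * a, +oo[) f x =
    \int[mu]_(x in `]c * a, +oo[) ((f x + `|f x|) - `|f x|).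
  by apply: eq_Rintegral => x _; rewrite addrK.
have -> : \int[mu]_(x in `]a, +oo[) f (c * x) =
    \int[mu]_(x in `]a, +oo[) ((f (c * x) + `|f (c * x)|) - `|f (c * x)|).
  by apply: eq_Rintegral => x _; rewrite addrK.
rewrite RintegralB// RintegralB//; last 2 first.
- exact: (integrable_scale c0 csf infs).
- exact: (integrable_scale c0 cnf infn).
rewrite mulrBr; congr (_ - _).
- by rewrite (E0 (fun x => f x + `|f x|))// => x; rewrite -lerBlDr sub0r lerNnormlW.
- exact: (E0 (fun x => `|f x|)).
Qed.

(** Extending f by 0 outside the rectangle reduces the claim to the full product. The integrability
    of both partial integrals is returned as well: it is what allows sums of such integrals to be
    split later. *)
Lemma Rintegral_Fubini d1 d2 (T1 : measurableType d1) (T2 : measurableType d2)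
    (m1 : {sigma_finite_measure set T1 -> \bar R})
    (m2 : {sigma_finite_measure set T2 -> \bar R})
    (D1 : set T1) (D2 : set T2) (f : T1 * T2 -> R) :
  measurable D1 -> measurable D2 -> measurable_fun setT f ->
  (\int[m1]_(x in D1) \int[m2]_(y in D2) `|f (x, y)|%:E < +oo)%E ->
  [/\ m1.-integrable D1 (fun x => \int[m2]_(y in D2) (f (x, y))%:E)%E,
    m2.-integrable D2 (fun y => \int[m1]_(x in D1) (f (x, y))%:E)%E &
    (\int[m1]_(x in D1) \int[m2]_(y in D2) (f (x, y))%:E =
     \int[m2]_(y in D2) \int[m1]_(x in D1) (f (x, y))%:E)%E].
Proof.
move=> mD1 mD2 mf fin.
pose g := f \_ (D1 `*` D2).
have mg : measurable_fun setT g.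
  apply/(measurable_restrict f) => //; first exact: measurableX.
  by rewrite setTI; apply: measurable_funS mf => //; exact: measurableX.
have g1 x : (\int[m2]_y (g (x, y))%:E =
    ((fun x => \int[m2]_(y in D2) (f (x, y))%:E) \_ D1) x)%E.
  rewrite patchE; case: ifPn => xD1.
    rewrite [RHS]integral_mkcond; apply: eq_integral => y _.
    rewrite /g !patchE; have [yD2|yD2] := boolP (y \in D2).
      by rewrite mem_set//; split; exact: set_mem.
    by rewrite memNset// => -[_ /= /mem_set]; rewrite (negbTE yD2).
  apply: integral0_eq => y _; rewrite /g patchE memNset//.
  by move=> -[/= /mem_set]; rewrite (negbTE xD1).
have g2 y : (\int[m1]_x (g (x, y))%:E =
    ((fun y => \int[m1]_(x in D1) (f (x, y))%:E) \_ D2) y)%E.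
  rewrite patchE; case: ifPn => xD1.
    rewrite [RHS]integral_mkcond; apply: eq_integral => x _.
    rewrite /g !patchE; have [yD2|yD2] := boolP (x \in D1).
      by rewrite mem_set//; split; exact: set_mem.
    by rewrite memNset// => -[/= /mem_set]; rewrite (negbTE yD2).
  apply: integral0_eq => x _; rewrite /g patchE memNset//.
  by move=> -[/= _ /mem_set]; rewrite (negbTE xD1).
have ng1 x : (\int[m2]_y `|(g (x, y))%:E| =
    ((fun x => \int[m2]_(y in D2) `|f (x, y)|%:E) \_ D1) x)%E.
  rewrite patchE; case: ifPn => xD1.
    rewrite [RHS]integral_mkcond; apply: eq_integral => y _.
    rewrite /g !patchE; have [yD2|yD2] := boolP (y \in D2).
      by rewrite mem_set//; split; exact: set_mem.
    rewrite memNset; first exact: (@abse0 R).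
    by move=> -[_ /= /mem_set]; rewrite (negbTE yD2).
  apply: integral0_eq => y _; rewrite /g patchE memNset; first exact: (@abse0 R).
  by move=> -[/= /mem_set]; rewrite (negbTE xD1).
have ig : (m1 \x m2)%E.-integrable setT (EFin \o g).
  apply/integrable12ltyP; first exact/measurable_EFinP.
  under eq_integral do rewrite ng1.
  by rewrite -integral_mkcond.
have ig' : (m2 \x m1)%E.-integrable setT (EFin \o (fun z : T2 * T1 => g (z.2, z.1))).
  apply/integrable12ltyP.
    apply/measurable_EFinP; apply: (measurableT_comp mg).
    exact: measurable_fun_pair measurable_snd measurable_fst.
  by move: ig => /integrable21ltyP; apply; exact/measurable_EFinP.
have i1 := integrable_fubini_F ig; have i2 := integrable_fubini_F ig'.
split.
- apply/(integrable_mkcond _ mD1); move: i1; congr (integrable _ _ _).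
  by apply/funext => x; rewrite -g1.
- apply/(integrable_mkcond _ mD2); move: i2; congr (integrable _ _ _).
  by apply/funext => x; rewrite -g2.
have := Fubini ig; rewrite /=.
under eq_integral do rewrite g1.
under [in X in _ = X -> _]eq_integral do rewrite g2.
by rewrite -!integral_mkcond.
Qed.

End scaling_and_Fubini.

(** * Derivatives of explicit expressions *)

Section pointwise_derivatives.
Context {R : realType}.
Implicit Types (f g : R -> R) (x a b : R).

(* An alias that typeclass resolution does not unfold, so that the derivative
   computed for a compound expression has a predictable shape. *)
Definition has_derive x f a := is_derive x 1 f a.

Lemma has_derive_eq f x a b : has_derive x f a -> a = b -> is_derive x 1 f b.
Proof. by move=> + <-. Qed.

Lemma has_derive_fctD f g x a b : has_derive x f a -> has_derive x g b ->
  has_derive x (fun y => f y + g y) (a + b).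
Proof. exact: is_deriveD. Qed.

Lemma has_derive_fctN f x a : has_derive x f a ->
  has_derive x (fun y => - f y) (- a).
Proof. exact: is_deriveN. Qed.

Lemma has_derive_fctM f g x a b : has_derive x f a -> has_derive x g b ->
  has_derive x (fun y => f y * g y) (f x * b + g x * a).
Proof. exact: is_deriveM. Qed.

Lemma has_derive_fct_cos f x a : has_derive x f a ->
  has_derive x (fun y => cos (f y)) (- sin (f x) * a).
Proof. by move=> df; apply: (is_derive1_comp (f := cos)). Qed.

Lemma has_derive_fct_sin f x a : has_derive x f a ->
  has_derive x (fun y => sin (f y)) (cos (f x) * a).
Proof. by move=> df; apply: (is_derive1_comp (f := sin)). Qed.

Lemma has_derive_fct_expR f x a : has_derive x f a ->
  has_derive x (fun y => expR (f y)) (expR (f x) * a).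
Proof. by move=> df; apply: (is_derive1_comp (f := expR)). Qed.

Lemma has_derive_fct_id x : has_derive x (fun y : R => y) 1.
Proof. exact: is_derive_id. Qed.

Lemma has_derive_fct_cst x a : has_derive x (fun y : R => a) 0.
Proof. exact: is_derive_cst. Qed.

Lemma has_derive_fctX f n x a : has_derive x f a ->
  has_derive x (fun y => f y ^+ n) (n%:R * f x ^+ n.-1 * a).
Proof.
move=> df; elim: n => [|n IH].
  by rewrite !mul0r; exact: (has_derive_fct_cst x 1).
rewrite (_ : (fun y => _) = fun y => f y * f y ^+ n); last first.
  by apply/funext => y; rewrite exprS.
rewrite /has_derive; apply: has_derive_eq (has_derive_fctM df IH) _.
case: n {IH} => [|n] /=; first by rewrite expr0; ring.
by rewrite -[n.+2%:R]natr1 (exprS (f x) n); ring.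
Qed.

Lemma has_derive_fctV f x a : f x != 0 -> has_derive x f a ->
  has_derive x (fun y => (f y)^-1) (- a / f x ^+ 2).
Proof.
move=> fx0 df; have [df1 df2] : is_derive x 1 f a := df.
split; first exact: derivableV.
by rewrite deriveV// df2 /GRing.scale/= mulNr mulrC mulNr.
Qed.

Lemma is_derive_continuous f x a : is_derive x 1 f a -> {for x, continuous f}.
Proof. by case=> + _ => /derivable1_diffP/differentiable_continuous. Qed.

End pointwise_derivatives.

(** Constants are tried first, so that a subexpression free of the variable gets derivative 0
    instead of being decomposed. What remains is the equality with the announced derivative. *)
Ltac derive_eq := apply: has_derive_eq; [
  repeat first [ apply: has_derive_fct_cst | apply: has_derive_fct_id
   | apply: has_derive_fctD | apply: has_derive_fctN | apply: has_derive_fctM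
   | apply: has_derive_fctX | apply: has_derive_fct_cos | apply: has_derive_fct_sin
   | apply: has_derive_fct_expR ] | ].

(** * Integrability by comparison with powers *)

Section domination.
Context {R : realType}.
Notation mu := (@lebesgue_measure R).

Lemma integrableZl_EFin d (T : measurableType d) (m : {measure set T -> \bar R})
    (D : set T) (k : R) (f : T -> R) : measurable D ->
  m.-integrable D (EFin \o f) -> m.-integrable D (EFin \o (fun x => k * f x)).
Proof. by move=> mD intf; exact: (integrableZl mD k intf). Qed.

Lemma integrableB_EFin d (T : measurableType d) (m : {measure set T -> \bar R})
    (D : set T) (f g : T -> R) : measurable D ->
  m.-integrable D (EFin \o f) -> m.-integrable D (EFin \o g) ->
  m.-integrable D (EFin \o (fun x => f x - g x)).
Proof. by move=> mD intf intg; exact: (integrableB mD intf intg). Qed.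

Lemma integrable_setU d (T : measurableType d) (m : {measure set T -> \bar R})
    (A B : set T) (f : T -> R) : measurable A -> measurable B ->
  [disjoint A & B] -> m.-integrable A (EFin \o f) ->
  m.-integrable B (EFin \o f) -> m.-integrable (A `|` B) (EFin \o f).
Proof.
move=> mA mB AB /integrableP[mfA iA] /integrableP[mfB iB].
have mf : measurable_fun (A `|` B) (EFin \o f) by exact/measurable_funU.
apply/integrableP; split => //.
rewrite ge0_integral_setU//; first exact: lte_add_pinfty.
exact: measurableT_comp.
Qed.

Lemma itv0y_split (c : R) : 0 < c -> `]0, +oo[%classic = `]0, c] `|` `]c, +oo[.
Proof. by move=> c0; rewrite -itv_bndbnd_setU ?bnd_simp ?ltW. Qed.

Lemma disj_itv_split (c : R) (a : itv_bound R) (b : itv_bound R) :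
  [disjoint [set` Interval a (BRight c)] & [set` Interval (BRight c) b]].
Proof.
apply/disj_setPS => x [/=]; rewrite !itv_boundlr => /andP[_ xc] /andP[cx _].
by have := lt_le_trans cx xc; rewrite ltxx.
Qed.

Lemma integrable_dom_powR (f : R -> R) (C r1 r2 : R) :
  measurable_fun `](0 : R), +oo[ f -> -1 < r1 -> r2 < -1 ->
  (forall u, 0 < u <= 1 -> `|f u| <= C * u `^ r1) ->
  (forall u, 1 < u -> `|f u| <= C * u `^ r2) ->
  mu.-integrable `]0, +oo[ (EFin \o f).
Proof.
move=> mf r1p r2p f1 f2; rewrite (@itv0y_split 1)// in mf *.
have mf1 : measurable_fun `](0 : R), 1] f by apply: measurable_funS mf => //; exact: measurableU.
have mf2 : measurable_fun `](1 : R), +oo[ f by apply: measurable_funS mf => //; exact: measurableU.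
apply: integrable_setU => //; first exact: disj_itv_split.
- apply: (@integrable_le_abs R _ _ mu _ f (fun u : R => C * u `^ r1)) => //.
  by apply: integrableZl_EFin => //; exact: integrable_powR_0c.
- apply: (@integrable_le_abs R _ _ mu _ f (fun u : R => C * u `^ r2)) => //.
    by move=> x; rewrite /= in_itv/= andbT; exact: f2.
  by apply: integrableZl_EFin => //; exact: integrable_powR_oy.
Qed.

(** The exponential dominates the term of order m + 2 of its series; the two orders beyond m leave
    u^-2, integrable at infinity. *)
Lemma expRN_le_powR (m : nat) (s u : R) : 0 < s -> 0 < u ->
  u ^+ m * expR (- (u * s)) <= m.+2`!%:R / s ^+ m.+2 * u `^ (- 2).
Proof.
move=> s0 u0.
have us : 0 < u * s by rewrite mulr_gt0.
have F0 : (0 : R) < m.+2`!%:R by rewrite ltr0n fact_gt0.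
have h : (u * s) ^+ m.+2 / m.+2`!%:R <= expR (u * s).
  by apply: le_trans (expR_ge1Dxn m.+1 (ltW us)); rewrite lerDr.
rewrite powR_invn ?(ltW u0)// expRN.
rewrite ler_pdivrMr ?expR_gt0//.
apply: le_trans (_ : m.+2`!%:R / s ^+ m.+2 / u ^+ 2 * ((u * s) ^+ m.+2 / m.+2`!%:R) <= _).
  rewrite exprMn [X in _ <= X](_ : _ = u ^+ m)//.
  have sm : s ^+ m.+2 != 0 by rewrite gt_eqF// exprn_gt0.
  rewrite !(exprS u); move: (s ^+ m.+2) (m.+2`!%:R) sm F0 => S F S0 F0.
  by field; rewrite S0 !gt_eqF.
by apply: ler_wpM2l => //; rewrite !divr_ge0 ?exprn_ge0 ?(ltW u0) ?(ltW s0) ?(ltW F0).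
Qed.

End domination.

(** * Taylor remainders of the cosine and their Laplace transforms *)

Section tcos.
Context {R : realType}.
Notation mu := (@lebesgue_measure R).

(* The remainder of order n of the Taylor expansion at 0 of u |-> cos (u + f):
   the phase f accounts for real and imaginary parts and for derivatives alike. *)
Definition tcos (n : nat) (f u : R) : R :=
  cos (u + f) - \sum_(j < n) u ^+ j / j`!%:R * cos (f + j%:R * (pi / 2)).

Lemma tcos0E f : tcos 0 f = fun u => cos (u + f).
Proof. by apply/funext => u; rewrite /tcos big_ord0 subr0. Qed.

Lemma tcosS n f : tcos n.+1 f =
  fun u => tcos n f u - u ^+ n / n`!%:R * cos (f + n%:R * (pi / 2)).
Proof. by apply/funext => u; rewrite /tcos big_ord_recr/= opprD addrA. Qed.

Lemma tcosS_0 n f : tcos n.+1 f 0 = 0.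
Proof.
elim: n => [|n IH]; last by rewrite tcosS IH expr0n/= !mul0r subrr.
by rewrite tcosS tcos0E expr0 fact0 divr1 mul1r mul0r addr0 add0r subrr.
Qed.

Lemma is_derive_tcos0 (f u : R) : is_derive u 1 (tcos 0 f) (tcos 0 (f + pi / 2) u).
Proof.
rewrite !tcos0E; derive_eq.
by rewrite addr0 mulr1 addrA cosDpihalf.
Qed.

Lemma is_derive_tcos n (f u : R) :
  is_derive u 1 (tcos n.+1 f) (tcos n (f + pi / 2) u).
Proof.
elim: n => [|n IH].
  rewrite tcosS; apply: has_derive_eq.
    by apply: has_derive_fctD; [exact: is_derive_tcos0|exact: (has_derive_fct_cst _ (- (1 / 0`!%:R * cos (f + 0%:R * (pi / 2)))))].
  by rewrite addr0.
rewrite tcosS (tcosS n (f + _)); apply: has_derive_fctD; first exact: IH.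
derive_eq; rewrite /=.
have -> : f + n.+1%:R * (pi / 2) = f + pi / 2 + n%:R * (pi / 2).
  by rewrite -natr1; ring.
have n0 : n`!%:R != 0 :> R by rewrite pnatr_eq0 -lt0n fact_gt0.
have n1 : n.+1%:R != 0 :> R by rewrite pnatr_eq0.
rewrite factS natrM; move: (u ^+ n.+1) (u ^+ n) (cos _) n0 n1.
move: (n`!%:R : R) (n.+1%:R : R) => F N U V c n0 n1.
by field; rewrite n0 n1.
Qed.

Lemma continuous_tcos n f : continuous (tcos n f).
Proof.
case: n => [|n] u.
  exact: is_derive_continuous (is_derive_tcos0 f u).
exact: is_derive_continuous (is_derive_tcos n f u).
Qed.

Lemma measurable_tcos n f : measurable_fun setT (tcos n f).
Proof. by apply: continuous_measurable_fun; exact: continuous_tcos. Qed.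

(** Induction by the mean value theorem, the derivative being a remainder of lower order. The
    factorial is given up, since only the exponent matters. *)
Lemma norm_tcos n f u : 0 <= u -> `|tcos n f u| <= u ^+ n.
Proof.
elim: n f u => [|n IH] f u u0; first by rewrite tcos0E expr0 cos_max.
move: u0; rewrite le_eqVlt => /predU1P[<-|u0].
  by rewrite tcosS_0 normr0 expr0n.
have [//|//|c + E] := @MVT _ (tcos n.+1 f) (tcos n (f + pi / 2)) 0 u u0.
- by move=> x _; exact: is_derive_tcos.
- by apply: continuous_subspaceT; exact: continuous_tcos.
rewrite in_itv/= => /andP[c0 cu].
move: E; rewrite tcosS_0 !subr0 => ->; rewrite normrM (gtr0_norm u0) exprSr.
apply: ler_wpM2r; first exact: ltW.
apply: le_trans (IH _ _ (ltW c0)) _.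
by apply: lerXn2r; rewrite ?nnegrE ltW// (lt_trans c0).
Qed.

(** Removing the last Taylor term, of degree n, leaves the remainder of order n; each is at most
    u^n. For [tcos n.+1] this gives growth u^n at infinity against u^(n+1) near 0, two exponents
    that enclose p. *)
Lemma norm_tcosS n f u : 0 <= u -> `|tcos n.+1 f u| <= 2 * u ^+ n.
Proof.
move=> u0; rewrite tcosS (mulr_natl (u ^+ n) 2) mulr2n (le_trans (ler_normB _ _))//.
rewrite lerD// ?norm_tcos//.
rewrite !normrM normfV (ger0_norm (exprn_ge0 _ u0)) [X in _ * X^-1]ger0_norm ?ler0n//.
rewrite -mulrA ler_piMr ?exprn_ge0// mulr_ile1 ?invr_ge0 ?cos_max//.
by rewrite invf_le1 ?ltr0n ?fact_gt0// ler1n fact_gt0.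
Qed.

(** The parity of the Taylor coefficients under a change of sign of the phase, as needed for
    [tcosN]. *)
Lemma cosBNpihalf n (f : R) :
  (-1) ^+ n * cos (f + n%:R * (pi / 2)) = cos (- f + n%:R * (pi / 2)).
Proof.
elim: n f => [|n IH] f; first by rewrite expr0 mul1r !mul0r !addr0 cosN.
have E (g : R) : g + n.+1%:R * (pi / 2) = (g + pi / 2) + n%:R * (pi / 2).
  by rewrite -natr1 mulrDl mul1r -addrA (addrC (pi / 2)).
rewrite !E exprS -mulrA IH mulN1r.
have -> : - f + pi / 2 = - (f + pi / 2) + pi by lra.
by rewrite addrAC cosDpi.
Qed.

Lemma tcosN n f u : tcos n f (- u) = tcos n (- f) u.
Proof.
elim: n => [|n IH]; first by rewrite !tcos0E -cosN opprD opprK.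
rewrite !tcosS IH -cosBNpihalf (exprNn u); congr (_ - _).
move: ((-1) ^+ n) (u ^+ n) (n`!%:R^-1) (cos _) => a b c e.
by ring.
Qed.

Lemma tcosDpi n f u : tcos n (f + pi) u = - tcos n f u.
Proof.
elim: n => [|n IH]; first by rewrite !tcos0E addrA cosDpi.
by rewrite !tcosS IH addrAC cosDpi; ring.
Qed.

(** One of the two parts of x is 0, where a remainder of positive order vanishes. *)
Lemma tcos_split n f x t : 0 <= t ->
  tcos n.+1 f (t * x) = tcos n.+1 f (t * Num.max x 0) +
                        tcos n.+1 (- f) (t * Num.max (- x) 0).
Proof.
move=> t0; have [x0|x0] := leP 0 x.
  by rewrite max_r ?oppr_le0// mulr0 tcosS_0 addr0.
rewrite max_l ?oppr_ge0 ?(ltW x0)// mulr0 tcosS_0 add0r.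
by rewrite mulrN tcosN opprK.
Qed.

Lemma integrable_tcos_expR n f Y s : 0 <= Y -> 0 < s ->
  mu.-integrable `]Y, +oo[ (EFin \o (fun u => tcos n f u * expR (- (u * s)))).
Proof.
move=> Y0 s0; apply: (@integrableS _ _ _ mu `]0, +oo[) => //.
  by apply: subset_itvr; rewrite bnd_simp.
have C0 : 0 <= n.+2`!%:R / s ^+ n.+2 by rewrite divr_ge0// exprn_ge0// ltW.
apply: (@integrable_dom_powR _ _ (1 + n.+2`!%:R / s ^+ n.+2) 0 (- 2)).
- apply: measurable_funM; first exact: (measurable_funTS (measurable_tcos n f)).
  apply: measurableT_comp => //; apply: measurable_funTS.
  by apply: measurableT_comp => //; apply: measurable_funM.
- by rewrite ltrN10.
- by rewrite ltrN2 ltr1n.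
- move=> u /andP[u0 u1]; rewrite powRr0 mulr1 normrM.
  apply: (@le_trans _ _ 1); last by rewrite lerDl.
  rewrite mulr_ile1//; first by rewrite (le_trans (norm_tcos _ _ (ltW u0)))// exprn_ile1// ltW.
  by rewrite ger0_norm ?expR_ge0// -expR0 ler_expR oppr_le0 mulr_ge0// ltW.
- move=> u u1; have u0 : 0 < u by rewrite (lt_trans _ u1).
  rewrite normrM [`|expR _|]ger0_norm ?expR_ge0//.
  apply: (@le_trans _ _ (u ^+ n * expR (- (u * s)))).
    by apply: ler_wpM2r; [exact: expR_ge0|exact: norm_tcos (ltW u0)].
  apply: (le_trans (expRN_le_powR n s0 u0)).
  by apply: ler_wpM2r; [exact: powR_ge0|rewrite lerDr].
Qed.

Lemma tcos_expR_cvgy n f s : 0 < s ->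
  tcos n f u * expR (- (u * s)) @[u --> +oo] --> 0.
Proof.
move=> s0; apply: norm_cvg0.
have C0 : 0 <= n.+2`!%:R / s ^+ n.+2 by rewrite divr_ge0// exprn_ge0// ltW.
apply: (@squeeze_cvgr _ _ _ _ (cst 0) (fun u => n.+2`!%:R / s ^+ n.+2 * u `^ (- 2))).
- near=> u; have u0 : 0 < u by near: u; apply: nbhs_pinfty_gt; exact: num_real.
  rewrite normr_ge0/= normrM [`|expR _|]ger0_norm ?expR_ge0//.
  apply: (@le_trans _ _ (u ^+ n * expR (- (u * s)))).
    by apply: ler_wpM2r; [exact: expR_ge0|exact: norm_tcos (ltW u0)].
  exact: expRN_le_powR.
- exact: cvg_cst.
- rewrite -[X in _ --> X](mulr0 (n.+2`!%:R / s ^+ n.+2)).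
  by apply: cvgM; [exact: cvg_cst|apply: powR_cvgy0; rewrite oppr_lt0].
Unshelve. all: end_near. Qed.

(** A Laplace transform cut off below [Y]: the cut at 0 serves the exact values, the cut at a
    multiple of the period serves the sign of the kernel. *)
Definition Lap n f Y s := \int[mu]_(u in `]Y, +oo[) (tcos n f u * expR (- (u * s))).

Lemma is_derive_expRN (s u : R) : is_derive u 1 (fun u : R => expR (- (u * s))) (- s * expR (- (u * s))).
Proof. by derive_eq; rewrite /=; ring. Qed.

Lemma continuous_tcos_expR n f s : continuous (fun u => tcos n f u * expR (- (u * s))).
Proof.
move=> u; apply: cvgM; first exact: continuous_tcos.
exact: is_derive_continuous (is_derive_expRN s u).
Qed.

(** Integration by parts: differentiating [tcos n.+1 f] lowers the order and adds pi / 2 to the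
    phase, and the boundary term at infinity vanishes. *)
Lemma LapS n f Y s : 0 <= Y -> 0 < s ->
  s * Lap n.+1 f Y s = tcos n.+1 f Y * expR (- (Y * s)) + Lap n (f + pi / 2) Y s.
Proof.
move=> Y0 s0.
have i1 := integrable_tcos_expR n (f + pi / 2) Y0 s0.
have i2 := integrable_tcos_expR n.+1 f Y0 s0.
have i2' : mu.-integrable `]Y, +oo[ (EFin \o (fun u => s * (tcos n.+1 f u * expR (- (u * s))))).
  exact: integrableZl_EFin.
have := @Rintegral_FTCoy R
  (fun u => tcos n (f + pi / 2) u * expR (- (u * s)) - s * (tcos n.+1 f u * expR (- (u * s))))
  (fun u => tcos n.+1 f u * expR (- (u * s))) Y (tcos n.+1 f Y * expR (- (Y * s))) 0.
rewrite RintegralB// RintegralZl// -/(Lap _ _ _ _) -/(Lap _ _ _ _) => E.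
rewrite (_ : s * _ = Lap n (f + pi / 2) Y s -
  (Lap n (f + pi / 2) Y s - s * Lap n.+1 f Y s)); last by ring.
suff -> : Lap n (f + pi / 2) Y s - s * Lap n.+1 f Y s = 0 - tcos n.+1 f Y * expR (- (Y * s)) by ring.
apply: E.
- move=> x _; apply: cvgB; first exact: continuous_tcos_expR.
  by apply: cvgM; [exact: cvg_cst|exact: continuous_tcos_expR].
- move=> x _; apply: has_derive_eq.
    apply: has_derive_fctM; [exact: is_derive_tcos|exact: is_derive_expRN].
  by rewrite /=; ring.
- by apply: cvg_at_right_filter; exact: continuous_tcos_expR.
- exact: tcos_expR_cvgy.
- exact: integrableB_EFin.
Qed.

Lemma Lap0 f Y s : 0 <= Y -> 0 < s ->
  Lap 0 f Y s = expR (- (Y * s)) * (s * cos (Y + f) - sin (Y + f)) / (1 + s ^+ 2).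
Proof.
move=> Y0 s0; have i1 := integrable_tcos_expR 0 f Y0 s0.
have s1 : 1 + s ^+ 2 != 0 by rewrite gt_eqF// ltr_pwDl// sqr_ge0.
(* Here [tcos 0 (f - pi / 2) u] is sin (u + f), and [F] is the real part of e^(i (u + f) - s u) / (i
   - s). *)
pose F u := (tcos 0 (f - pi / 2) u - s * tcos 0 f u) / (1 + s ^+ 2) * expR (- (u * s)).
have FE u : F u = (tcos 0 (f - pi / 2) u * expR (- (u * s)) - s * (tcos 0 f u * expR (- (u * s)))) / (1 + s ^+ 2).
  by rewrite /F; field.
have cF u : {for u, continuous F}.
  rewrite (_ : F = fun u => (tcos 0 (f - pi / 2) u * expR (- (u * s)) - s * (tcos 0 f u * expR (- (u * s)))) / (1 + s ^+ 2)); last exact/funext.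
  apply: cvgM; last exact: cvg_cst.
  apply: cvgB; first exact: continuous_tcos_expR.
  by apply: cvgM; [exact: cvg_cst|exact: continuous_tcos_expR].
have tE g u : tcos 0 g u = cos (u + g) by rewrite tcos0E.
rewrite (_ : _ / _ = 0 - F Y); last first.
  by rewrite /F !tE sub0r addrA cosBpihalf; field.
rewrite /Lap; apply: (@Rintegral_FTCoy R (fun u => tcos 0 f u * expR (- (u * s))) F Y (F Y) 0).
- by move=> x _; exact: continuous_tcos_expR.
- move=> x _; rewrite /F; apply: has_derive_eq.
    apply: has_derive_fctM; last exact: is_derive_expRN.
    apply: has_derive_fctM; last exact: has_derive_fct_cst.
    apply: has_derive_fctD; first exact: is_derive_tcos0.
    apply: has_derive_fctN; apply: has_derive_fctM; first exact: has_derive_fct_cst.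
    exact: is_derive_tcos0.
  rewrite /= !tE subrK !addrA cosDpihalf cosBpihalf; field.
  by [].
- by apply: cvg_at_right_filter; exact: cF.
- rewrite (_ : F = fun u => (tcos 0 (f - pi / 2) u * expR (- (u * s)) - s * (tcos 0 f u * expR (- (u * s)))) / (1 + s ^+ 2)); last exact/funext.
  have -> : (0 : R) = (0 - s * 0) / (1 + s ^+ 2) by rewrite mulr0 subr0 mul0r.
  apply: cvgM; last exact: cvg_cst.
  apply: cvgB; first exact: tcos_expR_cvgy.
  by apply: cvgM; [exact: cvg_cst|exact: tcos_expR_cvgy].
- exact: i1.
Qed.

(** At 0 all boundary terms of [LapS] vanish, so each order divides by s and turns the phase by pi /
    2. *)
Lemma Lap_at0 n f s : 0 < s ->
  Lap n f 0 s = (s * cos (f + n%:R * (pi / 2)) - sin (f + n%:R * (pi / 2))) / (1 + s ^+ 2) / s ^+ n.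
Proof.
move=> s0; elim: n f => [|n IH] f.
  by rewrite Lap0// !mul0r oppr0 expR0 mul1r add0r addr0 divr1.
have sn : s != 0 by rewrite gt_eqF.
apply: (mulfI sn); rewrite LapS// tcosS_0 mul0r add0r IH.
have -> : f + n.+1%:R * (pi / 2) = f + pi / 2 + n%:R * (pi / 2).
  by rewrite -natr1; ring.
have s1 : 1 + s ^+ 2 != 0 by rewrite gt_eqF// ltr_pwDl// sqr_ge0.
have sm : s ^+ n != 0 by rewrite expf_neq0.
by rewrite (exprS s n); move: (s ^+ n) sm => S S0; field; rewrite S0 sn.
Qed.

End tcos.

(** * The power u^-(p+1) as a Laplace integral *)

Section laplace_Fubini.
Context {R : realType}.
Notation mu := (@lebesgue_measure R).
Variables (n : nat) (p : R).
Hypotheses (np : n%:R < p) (pn : p < n.+1%:R).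

Let p0 : 0 < p. Proof. by apply: le_lt_trans np. Qed.

Lemma measurable_tcos_powR f : measurable_fun setT (fun u => tcos n.+1 f u * u `^ (- (p + 1))).
Proof. by apply: measurable_funM; [exact: measurable_tcos|exact: measurable_powR]. Qed.

Lemma norm_tcos_powR0 f u : 0 < u ->
  `|tcos n.+1 f u * u `^ (- (p + 1))| <= u `^ (n%:R - p).
Proof.
move=> u0; rewrite normrM [`|_ `^ _|]ger0_norm ?powR_ge0//.
apply: (@le_trans _ _ (u ^+ n.+1 * u `^ (- (p + 1)))).
  by apply: ler_wpM2r; [exact: powR_ge0|exact: norm_tcos (ltW u0)].
rewrite -powR_mulrn ?(ltW u0)// -powRD; last by rewrite (gt_eqF u0) implybT.
by rewrite -natr1 (_ : _ + _ = n%:R - p)//; ring.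
Qed.

Lemma norm_tcos_powRy f u : 0 < u ->
  `|tcos n.+1 f u * u `^ (- (p + 1))| <= 2 * u `^ (n%:R - p - 1).
Proof.
move=> u0; rewrite normrM [`|_ `^ _|]ger0_norm ?powR_ge0//.
apply: (@le_trans _ _ (2 * u ^+ n * u `^ (- (p + 1)))).
  by apply: ler_wpM2r; [exact: powR_ge0|exact: norm_tcosS (ltW u0)].
rewrite -mulrA -powR_mulrn ?(ltW u0)// -powRD; last by rewrite (gt_eqF u0) implybT.
by rewrite opprD addrA.
Qed.

Lemma integrable_tcos_powR f Y : 0 <= Y ->
  mu.-integrable `]Y, +oo[ (EFin \o (fun u => tcos n.+1 f u * u `^ (- (p + 1)))).
Proof.
move=> Y0; apply: (@integrableS _ _ _ mu `]0, +oo[) => //.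
  by apply: subset_itvr; rewrite bnd_simp.
apply: (@integrable_dom_powR _ _ 2 (n%:R - p) (n%:R - p - 1)).
- exact: (measurable_funTS (measurable_tcos_powR f)).
- by rewrite ltrBrDl; move: pn; rewrite -natr1 => ?; lra.
- by move: np => ?; lra.
- move=> u /andP[u0 _]; apply: le_trans (norm_tcos_powR0 f u0) _.
  by rewrite ler_peMl ?powR_ge0// ler1n.
- by move=> u u1; apply: norm_tcos_powRy; exact: lt_trans u1.
Qed.

Let gam (s : R) := s `^ p * expR (- s).

Let continuous_gam (s : R) : 0 < s -> {for s, continuous gam}.
Proof.
move=> s0; apply: cvgM; first exact: continuous_powR.
have := is_derive_expRN 1 s; under eq_fun do rewrite mulr1.
exact: is_derive_continuous.
Qed.

Let measurable_powR_expR (u : R) : measurable_fun setT (fun s : R => s `^ p * expR (- (u * s))).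
Proof.
apply: measurable_funM; first exact: measurable_powR.
by apply: measurableT_comp => //; apply: measurableT_comp => //.
Qed.

Let integrable_gam : mu.-integrable `]0, +oo[ (EFin \o gam).
Proof.
(* For s > 1, s^p is at most s^(n+1), and [expRN_le_powR] of order n + 1 brings in the factorial of
   n + 3. *)
apply: (@integrable_dom_powR _ _ (1 + n.+3`!%:R) p (- 2)).
- have := measurable_powR_expR 1; under eq_fun do rewrite mul1r.
  exact: measurable_funTS.
- by apply: lt_trans p0; rewrite oppr_lt0.
- by rewrite ltrN2 ltr1n.
- move=> s /andP[s0 s1]; rewrite /gam normrM !ger0_norm ?powR_ge0 ?expR_ge0//.
  rewrite mulrC; apply: ler_wpM2r; first exact: powR_ge0.
  apply: (@le_trans _ _ 1); last by rewrite lerDl ler0n.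
  by rewrite -expR0 ler_expR oppr_le0 ltW.
- move=> s s1; have s0 : 0 < s by exact: lt_trans s1.
  rewrite /gam normrM !ger0_norm ?powR_ge0 ?expR_ge0//.
  apply: (@le_trans _ _ (s ^+ n.+1 * expR (- (s * 1)))).
    rewrite mulr1; apply: ler_wpM2r; first exact: expR_ge0.
    by rewrite -powR_mulrn ?(ltW s0)//; apply: ler_powR; exact: ltW.
  apply: (le_trans (expRN_le_powR n.+1 ltr01 s0)).
  by rewrite expr1n divr1; apply: ler_wpM2r; [exact: powR_ge0|rewrite lerDr].
Qed.

Lemma GammaE : Gamma (p + 1) = \int[mu]_(s in `]0, +oo[) (s `^ p * expR (- s)).
Proof. by rewrite /Gamma addrK. Qed.

Let continuous_gam0 (u : R) : 0 < u -> {within `[(u * 0), +oo[, continuous gam}.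
Proof.
move=> u0; rewrite mulr0; apply/continuous_within_itvcyP; split.
  by move=> x; rewrite in_itv/= andbT; exact: continuous_gam.
have -> : gam 0 = 0 * expR (- 0) by rewrite /gam powR0// gt_eqF.
apply: cvgM.
  exact: powR_cvg0.
apply: cvg_at_right_filter.
have := is_derive_expRN 1 (0 : R); under eq_fun do rewrite mulr1.
exact: is_derive_continuous.
Qed.

Lemma integrable_powR_expR (u : R) : 0 < u ->
  mu.-integrable `]0, +oo[ (EFin \o (fun s => s `^ p * expR (- (u * s)))).
Proof.
move=> u0.
have := integrable_scale u0 (continuous_gam0 u0).
rewrite {1}mulr0 => /(_ integrable_gam).
move=> intg; have {intg} := @integrableZl_EFin R _ _ mu `]0, +oo[ (u `^ (- p)) _ (measurable_itv _) intg.
apply: eq_integrable => // s; rewrite inE/= in_itv/= andbT => s0.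
rewrite /gam powRM ?(ltW u0) ?(ltW s0)// !mulrA -powRD; last by rewrite (gt_eqF u0) implybT.
by rewrite addNr powRr0 mul1r.
Qed.

Lemma Gamma_scale (u : R) : 0 < u ->
  \int[mu]_(s in `]0, +oo[) (s `^ p * expR (- (u * s))) = Gamma (p + 1) * u `^ (- (p + 1)).
Proof.
move=> u0; rewrite GammaE.
have := Rintegral_scale u0 (continuous_gam0 u0).
rewrite {1 2}mulr0 => /(_ integrable_gam) ->.
have -> : \int[mu]_(x in `]0, +oo[) gam (u * x) =
    u `^ p * \int[mu]_(s in `]0, +oo[) (s `^ p * expR (- (u * s))).
  rewrite -RintegralZl//; last exact: integrable_powR_expR.
  apply: eq_Rintegral => s; rewrite inE/= in_itv/= andbT => s0.
  by rewrite /gam powRM ?(ltW u0) ?(ltW s0)// mulrA.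
rewrite mulrC mulrA mulrA -{3}[u]powRr1 ?(ltW u0)//.
rewrite -!powRD ?(gt_eqF u0) ?implybT//.
by rewrite (_ : _ + _ = 0) ?powRr0 ?mul1r//; ring.
Qed.

(** By [Gamma_scale] the left side is a double integral. The exchange is allowed because the same
    computation with absolute values returns Gamma(p + 1) |tcos| u^-(p+1), which is integrable. *)
Lemma laplace_tcos f Y : 0 <= Y ->
  Gamma (p + 1) * \int[mu]_(u in `]Y, +oo[) (tcos n.+1 f u * u `^ (- (p + 1))) =
  \int[mu]_(s in `]0, +oo[) (s `^ p * Lap n.+1 f Y s).
Proof.
move=> Y0.
have Yu u : u \in `]Y, +oo[%classic -> 0 < u.
  by rewrite inE/= in_itv/= andbT; exact: le_lt_trans.
pose F (z : R * R) : R := tcos n.+1 f z.1 * (z.2 `^ p * expR (- (z.1 * z.2))).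
have mF : measurable_fun setT F.
  apply: measurable_funM.
    exact: (measurableT_comp (measurable_tcos n.+1 f) measurable_fst).
  apply: measurable_funM.
    exact: (measurableT_comp (measurable_powR p) measurable_snd).
  apply: measurableT_comp => //; apply: measurableT_comp => //.
  exact: measurable_funM.
have ip u : 0 < u -> (\int[mu]_(s in `]0%R, +oo[) (s `^ p * expR (- (u * s)))%:E)%E =
    (Gamma (p + 1) * u `^ (- (p + 1)))%:E.
  move=> u0; rewrite -[LHS]fineK; last first.
    by apply: integrable_fin_num => //; exact: integrable_powR_expR.
  by rewrite -[fine _]/(Rintegral mu _ _) Gamma_scale.
have iu u : 0 < u -> (\int[mu]_(s in `]0%R, +oo[) (F (u, s))%:E)%E =
    (Gamma (p + 1) * (tcos n.+1 f u * u `^ (- (p + 1))))%:E.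
  move=> u0; rewrite /F /=.
  under eq_integral do rewrite EFinM.
  rewrite integralZl//=; last exact: integrable_powR_expR.
  by rewrite ip// -EFinM; congr EFin; ring.
have iau u : 0 < u -> (\int[mu]_(s in `]0%R, +oo[) `|F (u, s)|%:E)%E =
    (Gamma (p + 1) * `|tcos n.+1 f u * u `^ (- (p + 1))|)%:E.
  move=> u0; rewrite /F /=.
  under eq_integral do rewrite normrM EFinM [X in (_ * X%:E)%E]ger0_norm ?mulr_ge0 ?powR_ge0 ?expR_ge0//.
  rewrite integralZl//=; last exact: integrable_powR_expR.
  rewrite ip// -EFinM; congr EFin; rewrite normrM [X in _ = _ * (_ * X)]ger0_norm ?powR_ge0//.
  by ring.
have [|_ _] := @Rintegral_Fubini R _ _ _ _ mu mu `]Y, +oo[ `]0, +oo[ F (measurable_itv _) (measurable_itv _) mF.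
  under eq_integral => u uY do rewrite iau ?Yu// EFinM.
  apply: integrable_lty => //.
  apply: (@integrableZl_EFin R _ _ mu `]Y, +oo[ (Gamma (p + 1))
    (fun u : R => `|tcos n.+1 f u * u `^ (- (p + 1))|)) => //.
  exact: integrable_abse (integrable_tcos_powR f Y0).
under eq_integral => u uY do rewrite iu ?Yu//.
move=> E; rewrite -RintegralZl//; last exact: integrable_tcos_powR.
rewrite /Rintegral E; congr fine; apply: eq_integral => s.
rewrite inE/= in_itv/= andbT => s0; rewrite /F/=.
under eq_integral do rewrite mulrCA EFinM.
rewrite integralZl//=; last exact: integrable_tcos_expR.
rewrite EFinM /Lap fineK//; apply: integrable_fin_num => //; exact: integrable_tcos_expR.
Qed.

End laplace_Fubini.

(** * The Mellin integral of 1 / (1 + s^2) by real methods *)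

Section mellin.
Context {R : realType}.
Notation mu := (@lebesgue_measure R).

Definition Jint (a : R) := \int[mu]_(s in `]0, +oo[) (s `^ a / (1 + s ^+ 2)).

Definition Q0 (a : R) := \int[mu]_(s in `]0, 1]) (s `^ a / (1 + s ^+ 2)).

(** The sign of the exponent makes [Q1] obey the recurrence and the bound of [Q0], so that one
    alternating series represents both. *)
Definition Q1 (a : R) := \int[mu]_(s in `]1, +oo[) (s `^ (- a) / (1 + s ^+ 2)).

Let s2 (s : R) : 0 < 1 + s ^+ 2.
Proof. by rewrite ltr_pwDl// sqr_ge0. Qed.

Lemma continuous_1sqr : continuous (fun s : R => (1 + s ^+ 2)^-1).
Proof.
move=> s; have h : has_derive s (fun s : R => 1 + s ^+ 2) (0 + 2%:R * s ^+ 1 * 1).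
  apply: has_derive_fctD; first exact: has_derive_fct_cst.
  by apply: has_derive_fctX; exact: has_derive_fct_id.
by apply: is_derive_continuous (has_derive_fctV _ h); rewrite gt_eqF.
Qed.

Lemma measurable_mellin a : measurable_fun setT (fun s : R => s `^ a / (1 + s ^+ 2)).
Proof.
apply: measurable_funM; first exact: measurable_powR.
by apply: continuous_measurable_fun => s; exact: continuous_1sqr.
Qed.

Let norm_mellin a (s : R) : `|s `^ a / (1 + s ^+ 2)| <= s `^ a.
Proof.
rewrite ger0_norm ?divr_ge0 ?powR_ge0 ?(ltW (s2 _))//.
by rewrite ler_piMr ?powR_ge0// invf_le1// lerDl sqr_ge0.
Qed.

Let norm_melliny a (s : R) : 0 < s -> `|s `^ a / (1 + s ^+ 2)| <= s `^ (a - 2).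
Proof.
move=> s0; rewrite ger0_norm ?divr_ge0 ?powR_ge0 ?(ltW (s2 _))//.
rewrite powRD ?(gt_eqF s0) ?implybT// powR_invn ?(ltW s0)//.
by apply: ler_wpM2l; [exact: powR_ge0|rewrite lef_pV2 ?posrE ?exprn_gt0// lerDr].
Qed.

Lemma integrable_mellin a : -1 < a -> a < 1 ->
  mu.-integrable `]0, +oo[ (EFin \o (fun s => s `^ a / (1 + s ^+ 2))).
Proof.
move=> a1 a2; apply: (@integrable_dom_powR _ _ 1 a (a - 2)) => //.
- exact: measurable_funTS (measurable_mellin a).
- by lra.
- by move=> u _; rewrite mul1r.
- by move=> u u1; rewrite mul1r norm_melliny// (lt_trans _ u1).
Qed.

Let integrable_Q0 a : -1 < a ->
  mu.-integrable `]0, 1] (EFin \o (fun s => s `^ a / (1 + s ^+ 2))).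
Proof.
move=> a1; apply: (@integrable_le_abs R _ _ mu _ _ (fun s : R => s `^ a)) => //.
- exact: measurable_funTS (measurable_mellin a).
- exact: integrable_powR_0c.
Qed.

Let integrable_Q1 a : -1 < a ->
  mu.-integrable `]1, +oo[ (EFin \o (fun s => s `^ (- a) / (1 + s ^+ 2))).
Proof.
move=> a1; apply: (@integrable_le_abs R _ _ mu _ _ (fun s : R => s `^ (- a - 2))) => //.
- exact: measurable_funTS (measurable_mellin _).
- by move=> s; rewrite /= in_itv/= andbT => s1; apply: norm_melliny; exact: lt_trans s1.
- by apply: integrable_powR_oy => //; lra.
Qed.

Lemma JintE a : -1 < a -> a < 1 -> Jint a = Q0 a + Q1 (- a).
Proof.
move=> a1 a2; rewrite /Jint /Q0 /Q1 opprK (@itv0y_split R 1)// Rintegral_setU//.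
- by rewrite -itv0y_split//; exact: integrable_mellin.
- exact: disj_itv_split.
Qed.

(** Adding the two integrands cancels the denominator 1 + s^2. *)
Lemma Q0_rec a : -1 < a -> Q0 a + Q0 (a + 2) = (a + 1)^-1.
Proof.
move=> a1; have a3 : -1 < a + 2 by lra.
rewrite /Q0 -RintegralD//; [|exact: integrable_Q0..].
transitivity (\int[mu]_(s in `]0, 1]) s `^ a); last first.
  by rewrite Rintegral_powR_0c// powR1 mul1r.
apply: eq_Rintegral => s; rewrite inE/= in_itv/= => /andP[s0 _].
rewrite powRD ?(gt_eqF s0) ?implybT// (powR_mulrn 2)// ?(ltW s0)//.
by field; rewrite gt_eqF.
Qed.

Lemma Q1_rec a : -1 < a -> Q1 a + Q1 (a + 2) = (a + 1)^-1.
Proof.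
move=> a1; have a3 : -1 < a + 2 by lra.
rewrite /Q1 -RintegralD//; [|exact: integrable_Q1..].
transitivity (\int[mu]_(s in `]1, +oo[) s `^ (- a - 2)); last first.
  rewrite Rintegral_powR_oy//; last by lra.
  by rewrite powR1 mul1r; congr (_^-1); lra.
apply: eq_Rintegral => s; rewrite inE/= in_itv/= andbT => s1.
have s0 : 0 < s by exact: lt_trans s1.
rewrite opprD powRD ?(gt_eqF s0) ?implybT// (powR_invn 2)// ?(ltW s0)//.
by field; rewrite !gt_eqF.
Qed.

Lemma Q0_bound a : -1 < a -> 0 <= Q0 a <= (a + 1)^-1.
Proof.
move=> a1; have h b : 0 <= Q0 b.
  by apply: Rintegral_ge0 => s _; rewrite divr_ge0 ?powR_ge0 ?ltW.
by rewrite h -Q0_rec// lerDl h.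
Qed.

Lemma Q1_bound a : -1 < a -> 0 <= Q1 a <= (a + 1)^-1.
Proof.
move=> a1; have h b : 0 <= Q1 b.
  by apply: Rintegral_ge0 => s _; rewrite divr_ge0 ?powR_ge0 ?ltW.
by rewrite h -Q1_rec// lerDl h.
Qed.

(** Unrolling the recurrence N times leaves (-1)^N q(a + 2N), at most 1 / (a + 2N + 1) in absolute
    value. *)
Lemma alternating_rec (q : R -> R) :
  (forall a, -1 < a -> q a + q (a + 2) = (a + 1)^-1) ->
  (forall a, -1 < a -> 0 <= q a <= (a + 1)^-1) ->
  forall a, -1 < a ->
  \sum_(k < N) (-1) ^+ k / (k.*2.+1%:R + a) @[N --> \oo] --> q a.
Proof.
move=> qrec qb a a1.
have aN N : -1 < a + N.*2%:R.
  by rewrite (lt_le_trans a1)// lerDl ler0n.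
have E N : \sum_(k < N) (-1) ^+ k / (k.*2.+1%:R + a) = q a - (-1) ^+ N * q (a + N.*2%:R).
  elim: N => [|N IH]; first by rewrite big_ord0 mul1r addr0 subrr.
  rewrite big_ord_recr/= IH.
  have -> : (N.*2.+1%:R + a) = (a + N.*2%:R) + 1 by rewrite -natr1; ring.
  rewrite -qrec// exprS doubleS -[N.*2.+2%:R]natr1 -[N.*2.+1%:R]natr1.
  by rewrite (_ : a + (_ + 1 + 1) = a + N.*2%:R + 2); ring.
rewrite (_ : (fun N => _) = fun N => q a - (-1) ^+ N * q (a + N.*2%:R)); last exact/funext.
rewrite -[X in _ --> X]subr0; apply: cvgB; first exact: cvg_cst.
apply: norm_cvg0; apply: (@squeeze_cvgr _ _ _ _ (cst 0) (fun N => (a + N.*2%:R + 1)^-1)).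
- apply: nearW => N; rewrite normr_ge0/= normrM normrX normrN1 expr1n mul1r.
  by have /andP[q0 q1] := qb _ (aN N); rewrite ger0_norm.
- exact: cvg_cst.
- apply/gtr0_cvgV0.
    by apply: nearW => N; have := aN N; lra.
  apply/cvgryPge => A; near=> N.
  rewrite -lerBlDr -lerBlDl (@le_trans _ _ N%:R)//; last by rewrite ler_nat -addnn leq_addr.
  by near: N; exact: nbhs_infty_ger.
Unshelve. all: end_near. Qed.

Section dirichlet.
Variable a : R.
Hypothesis a1 : `|a| < 1.

Let m (k : nat) : R := k.*2.+1%:R.

(* V N and G N are primitives of D N and of cos (a t) D N vanishing at 0. At
   pi / 2 they are the partial sums of the alternating series for Jint 0 and for
   cos (a pi / 2) Jint a, and integrating by parts their difference is the
   integral of a sin (a t) (V N t - V N (pi / 2)), of order 1 / N. *)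
Let V N t := \sum_(k < N) 2 * (sin (m k * t) / m k).

Let D N t := \sum_(k < N) 2 * cos (m k * t).

Let G N t := \sum_(k < N) (sin ((m k + a) * t) / (m k + a) + sin ((m k - a) * t) / (m k - a)).

Let aN1 : -1 < a. Proof. by have /ltr_normlP[] := a1; lra. Qed.

Let aP1 : a < 1. Proof. by have /ltr_normlP[] := a1; lra. Qed.

Let m1 k : 1 <= m k. Proof. by rewrite ler1n. Qed.

Let m0 k : m k != 0. Proof. by rewrite gt_eqF// (lt_le_trans _ (m1 k)). Qed.

Let mp k : m k + a != 0.
Proof. by apply: lt0r_neq0; move: (m1 k) aN1 aP1; move: (m k) => M; lra. Qed.

Let mm k : m k - a != 0.
Proof. by apply: lt0r_neq0; move: (m1 k) aN1 aP1; move: (m k) => M; lra. Qed.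

Let dV N (t : R) : is_derive t 1 (V N) (D N t).
Proof.
elim: N => [|N IH].
  rewrite (_ : V 0 = cst 0); last by apply/funext => x; rewrite /V big_ord0.
  by rewrite /D big_ord0; exact: is_derive_cst.
rewrite (_ : V N.+1 = fun t => V N t + 2 * (sin (m N * t) / m N)); last first.
  by apply/funext => x; rewrite /V big_ord_recr.
rewrite /D big_ord_recr/=; apply: has_derive_fctD; first exact: IH.
rewrite /has_derive; derive_eq; rewrite /=.
by move: (m N) (m0 N) => M M0; field.
Qed.

Let dG N (t : R) : is_derive t 1 (G N) (cos (a * t) * D N t).
Proof.
elim: N => [|N IH].
  rewrite (_ : G 0 = cst 0); last by apply/funext => x; rewrite /G big_ord0.
  by rewrite /D big_ord0 mulr0; exact: is_derive_cst.
rewrite (_ : G N.+1 = fun t => G N t + (sin ((m N + a) * t) / (m N + a) + sin ((m N - a) * t) / (m N - a))); last first.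
  by apply/funext => x; rewrite /G big_ord_recr.
rewrite /D big_ord_recr/= mulrDr; apply: has_derive_fctD; first exact: IH.
rewrite /has_derive; derive_eq; rewrite /=.
move: (m N) (mp N) (mm N) => M Mp Mm.
rewrite mulrDl mulrBl !cosD cosN sinN.
by field; rewrite Mp Mm.
Qed.

(** Telescoping of 2 sin t cos ((2k+1) t) = sin ((2k+2) t) - sin (2k t). *)
Let sinD_kernel N (t : R) : sin t * D N t = sin (N.*2%:R * t).
Proof.
elim: N => [|N IH]; first by rewrite /D big_ord0 mulr0 mul0r sin0.
rewrite /D big_ord_recr/= mulrDr -/(D N t) IH.
have -> : N.*2%:R * t = m N * t - t by rewrite /m -natr1; ring.
have -> : N.+1.*2%:R * t = m N * t + t by rewrite /m doubleS -[N.*2.+2%:R]natr1; ring.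
by rewrite !sinD cosN sinN; ring.
Qed.

Let edge_sin (t : R) : 0 < t -> t < pi / 2 -> 0 < sin t.
Proof. by move=> t0 t1; rewrite sin_gt0_pihalf// t0. Qed.

(* For e = 1 the function is nonincreasing, for e = -1 it is nondecreasing; this
   squeezes V N t - V N (pi / 2) between multiples of 1 / (N sin t). *)
Let tail_deriv N (e c : R) : (0 < N)%N -> 0 < c -> c <= pi / 2 ->
  is_derive c 1 (fun t => V N t + (cos (N.*2%:R * t) + e) / (N.*2%:R * sin t))
   (- ((cos (N.*2%:R * c) + e) * cos c / (N.*2%:R * sin c ^+ 2))).
Proof.
move=> N0 c0 c1.
have s0 : sin c != 0.
  move: c1; rewrite le_eqVlt => /predU1P[->|c1]; first by rewrite sin_pihalf oner_neq0.
  by rewrite gt_eqF// edge_sin.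
have M0 : N.*2%:R != 0 :> R by rewrite pnatr_eq0 double_eq0 -lt0n.
apply: has_derive_eq.
  apply: has_derive_fctD; first exact: dV.
  apply: has_derive_fctM.
    apply: has_derive_fctD; last exact: has_derive_fct_cst.
    apply: has_derive_fct_cos; apply: has_derive_fctM; [exact: has_derive_fct_cst|exact: has_derive_fct_id].
  apply: has_derive_fctV; first by rewrite mulf_neq0.
  apply: has_derive_fctM; first exact: has_derive_fct_cst.
  by apply: has_derive_fct_sin; exact: has_derive_fct_id.
rewrite /= -sinD_kernel; field.
by rewrite M0 s0.
Qed.

(** The factor sin t absorbs the singularity at 0; in the application it is supplied by |sin (a t)|
    <= sin t. *)
Let tail_bound N (t : R) : (0 < N)%N -> 0 < t -> t < pi / 2 ->
  sin t * `|V N t - V N (pi / 2)| <= N%:R^-1.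
Proof.
move=> N0 t0 t1; have s0 := edge_sin t0 t1.
have M0 : (0 : R) < N.*2%:R by rewrite ltr0n double_gt0.
pose E e t := V N t + (cos (N.*2%:R * t) + e) / (N.*2%:R * sin t).
have mvt e : exists2 c, c \in `]t, pi / 2[ &
    E e (pi / 2) - E e t = - ((cos (N.*2%:R * c) + e) * cos c / (N.*2%:R * sin c ^+ 2)) * (pi / 2 - t).
  apply: (MVT t1).
    by move=> x; rewrite in_itv/= => /andP[x0 x1]; apply: tail_deriv => //; [exact: lt_trans x0|exact: ltW].
  apply: continuous_in_subspaceT => x /set_mem/=; rewrite in_itv/= => /andP[x0 x1].
  by apply: is_derive_continuous; apply: tail_deriv => //; exact: lt_le_trans x0.
have den c : c \in `]t, pi / 2[ -> 0 <= cos c / (N.*2%:R * sin c ^+ 2) * (pi / 2 - t).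
  rewrite in_itv/= => /andP[c0 c1].
  rewrite mulr_ge0 ?subr_ge0 ?(ltW t1)// divr_ge0//; last by rewrite mulr_ge0 ?sqr_ge0 ?ltW.
  by apply: cos_ge0_pihalf; rewrite (ltW c1) andbT; have := t0; have := c0; lra.
have x0 : 0 < N.*2%:R * sin t by rewrite mulr_gt0.
(* For e = 1 the added term is nonnegative at pi / 2 and at most 2 / (2N sin t) at t, whence the
   lower bound; e = -1 gives the upper one. *)
have main : `|V N t - V N (pi / 2)| <= 2 / (N.*2%:R * sin t).
  have cb (x : R) : -1 <= cos x <= 1 by rewrite cos_geN1 cos_le1.
  have q0 : 0 < N.*2%:R^-1 :> R by rewrite invr_gt0.
  have r0 : 0 < (N.*2%:R * sin t)^-1 by rewrite invr_gt0.
  rewrite ler_norml; apply/andP; split.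
  - have [c cI] := mvt 1; rewrite /E sin_pihalf mulr1 => Ec.
    have : 0 <= (cos (N.*2%:R * c) + 1) * (cos c / (N.*2%:R * sin c ^+ 2) * (pi / 2 - t)).
      by rewrite mulr_ge0 ?den// -lerBlDr sub0r; have /andP[] := cb (N.*2%:R * c).
    have : (0 : R) <= (cos (N.*2%:R * (pi / 2)) + 1) / N.*2%:R.
      by rewrite divr_ge0 ?(ltW M0)//; have /andP[] := cb (N.*2%:R * (pi / 2)); lra.
    have : (cos (N.*2%:R * t) + 1) / (N.*2%:R * sin t) <= 2 / (N.*2%:R * sin t).
      by rewrite ler_pM2r//; have /andP[] := cb (N.*2%:R * t); lra.
    move: Ec; rewrite mulNr -!mulrA.
    lra.
  - have [c cI] := mvt (-1); rewrite /E sin_pihalf mulr1 => Ec.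
    have : (cos (N.*2%:R * c) - 1) * (cos c / (N.*2%:R * sin c ^+ 2) * (pi / 2 - t)) <= 0.
      by rewrite mulr_le0_ge0 ?den// subr_le0; have /andP[] := cb (N.*2%:R * c).
    have : (cos (N.*2%:R * (pi / 2)) - 1) / N.*2%:R <= (0 : R).
      by rewrite mulr_le0_ge0 ?(ltW q0)//; have /andP[] := cb (N.*2%:R * (pi / 2)); lra.
    have : - 2 / (N.*2%:R * sin t) <= (cos (N.*2%:R * t) - 1) / (N.*2%:R * sin t).
      by rewrite ler_pM2r//; have /andP[] := cb (N.*2%:R * t); lra.
    move: Ec; rewrite mulNr mulNr -!mulrA.
    lra.
apply: (@le_trans _ _ (sin t * (2 / (N.*2%:R * sin t)))).
  by rewrite ler_pM2l.
rewrite -muln2 natrM le_eqVlt; apply/orP; left; apply/eqP; field.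
by rewrite pnatr_eq0 -lt0n N0 gt_eqF.
Qed.

Let norm_sin_le (t : R) : 0 < t -> t < pi / 2 -> `|sin (a * t)| <= sin t.
Proof.
move=> t0 t1; have a1' := aP1; have a2' := aN1.
have h (b : R) : - t <= b -> b <= t -> sin b <= sin t.
  move=> b1; rewrite le_eqVlt => /predU1P[->//|b2]; apply/ltW.
  by rewrite ltr_sin// in_itv/=; apply/andP; split; lra.
rewrite ler_norml; apply/andP; split.
  rewrite lerNl -sinN; apply: h; rewrite -?mulNr; nra.
by apply: h; nra.
Qed.

Let diff_bound N : (0 < N)%N -> `|G N (pi / 2) - V N (pi / 2)| <= pi / 2 / N%:R.
Proof.
move=> N0; have pi0 : 0 < pi / 2 :> R by rewrite divr_gt0 ?pi_gt0.
pose W t := V N t - V N (pi / 2).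
(* The integration by parts in primitive form: the last product vanishes at pi / 2 because [W] does
   and at 0 because cos - 1 does. The mean value theorem then stands in for the integral. *)
pose F t := G N t - V N t - (cos (a * t) - 1) * W t.
have dF (t : R) : is_derive t 1 F (a * sin (a * t) * W t).
  apply: has_derive_eq.
    apply: has_derive_fctD.
      apply: has_derive_fctD; first exact: dG.
      by apply: has_derive_fctN; exact: dV.
    apply: has_derive_fctN; apply: has_derive_fctM.
      apply: has_derive_fctD; last exact: has_derive_fct_cst.
      apply: has_derive_fct_cos; apply: has_derive_fctM; [exact: has_derive_fct_cst|exact: has_derive_fct_id].
    apply: has_derive_fctD; [exact: dV|exact: has_derive_fct_cst].
  by rewrite /= /W; ring.
have [c] := @MVT _ F (fun t => a * sin (a * t) * W t) 0 (pi / 2) pi0 (fun t _ => dF t)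
   (continuous_subspaceT (fun t => is_derive_continuous (dF t))).
rewrite in_itv/= => /andP[c0 c1].
have -> : F (pi / 2) = G N (pi / 2) - V N (pi / 2) by rewrite /F /W subrr mulr0 subr0.
have -> : F 0 = 0.
  rewrite /F mulr0 cos0 subrr mul0r subr0 /G /V !big1 ?subrr// => k _; rewrite !mulr0 sin0 !mul0r ?mulr0 ?addr0//.
rewrite !subr0 => ->; rewrite normrM (gtr0_norm pi0) mulrC ler_pM2l//.
apply: le_trans (tail_bound N0 c0 c1); rewrite normrM.
apply: ler_wpM2r => //; rewrite normrM -[leRHS]mul1r.
by apply: ler_pM => //; [exact: ltW|exact: norm_sin_le].
Qed.

Let G_end N : G N (pi / 2) = cos (a * (pi / 2)) *
  (\sum_(k < N) (-1) ^+ k / (m k + a) + \sum_(k < N) (-1) ^+ k / (m k + - a)).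
Proof.
have sc k : sin (m k * (pi / 2)) = (-1) ^+ k /\ cos (m k * (pi / 2)) = 0.
  elim: k => [|k [IH1 IH2]]; first by rewrite /m mul1r sin_pihalf cos_pihalf.
  have -> : m k.+1 * (pi / 2) = m k * (pi / 2) + pi.
    by rewrite /m doubleS -[k.*2.+3%:R]natr1 -[k.*2.+2%:R]natr1; field.
  by rewrite sinDpi cosDpi IH1 IH2 exprS mulN1r oppr0.
rewrite -big_split/= mulr_sumr; apply: eq_bigr => k _.
have [s c] := sc k.
move: (m k) (mp k) (mm k) s c => M Mp Mm s c.
rewrite mulrDl mulrBl !sinD cosN sinN s c; field.
by rewrite Mp Mm.
Qed.

Let V_end N : V N (pi / 2) = (\sum_(k < N) (-1) ^+ k / (m k + 0) + \sum_(k < N) (-1) ^+ k / (m k + 0)).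
Proof.
have sc k : sin (m k * (pi / 2)) = (-1) ^+ k.
  elim: k => [|k IH1]; first by rewrite /m mul1r sin_pihalf.
  have -> : m k.+1 * (pi / 2) = m k * (pi / 2) + pi.
    by rewrite /m doubleS -[k.*2.+3%:R]natr1 -[k.*2.+2%:R]natr1; field.
  by rewrite sinDpi IH1 exprS mulN1r.
by rewrite -big_split/=; apply: eq_bigr => k _; rewrite sc addr0; ring.
Qed.

Lemma cos_Jint_cst : cos (a * (pi / 2)) * Jint a = Jint 0.
Proof.
have pi0 : 0 < pi / 2 :> R by rewrite divr_gt0 ?pi_gt0.
have cQ0 := @alternating_rec Q0 Q0_rec Q0_bound.
have cQ1 := @alternating_rec Q1 Q1_rec Q1_bound.
have maN1 : -1 < - a by rewrite ltrN2.
have c1 : G N (pi / 2) @[N --> \oo] --> cos (a * (pi / 2)) * Jint a.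
  rewrite JintE// (_ : (fun N => _) = (fun N => cos (a * (pi / 2)) *
  (\sum_(k < N) (-1) ^+ k / (m k + a) + \sum_(k < N) (-1) ^+ k / (m k + - a)))); last exact/funext.
  by apply: cvgM; [exact: cvg_cst|apply: cvgD; [exact: cQ0|exact: cQ1]].
have c2 : V N (pi / 2) @[N --> \oo] --> Jint 0.
  rewrite JintE ?ltrN10 ?ltr01// oppr0 (_ : (fun N => _) = (fun N =>
  (\sum_(k < N) (-1) ^+ k / (m k + 0) + \sum_(k < N) (-1) ^+ k / (m k + 0)))); last exact/funext.
  by apply: cvgD; [apply: cQ0|apply: cQ1]; rewrite ltrN10.
have c3 : (G N (pi / 2) - V N (pi / 2)) @[N --> \oo] --> (0 : R).
  apply: norm_cvg0; apply: (@squeeze_cvgr _ _ _ _ (cst 0) (fun N => pi / 2 * N%:R^-1)).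
  - near=> N; rewrite normr_ge0/=; apply: diff_bound; near: N; exact: nbhs_infty_gt.
  - exact: cvg_cst.
  - rewrite -[X in _ --> X](mulr0 (pi / 2)); apply: cvgM; first exact: cvg_cst.
    apply/gtr0_cvgV0; last exact: cvgr_idn.
    by near=> N; rewrite ltr0n; near: N; exact: nbhs_infty_gt.
apply/eqP; rewrite -subr_eq0; apply/eqP.
have c4 : (G N (pi / 2) - V N (pi / 2)) @[N --> \oo] --> cos (a * (pi / 2)) * Jint a - Jint 0.
  exact: cvgB.
by move/(cvg_lim (@norm_hausdorff _ _)) : c4 => <-; exact/(cvg_lim (@norm_hausdorff _ _)).
Unshelve. all: end_near. Qed.

End dirichlet.

Lemma Jint_0 : Jint 0 = pi / 2.
Proof.
have -> : pi / 2 = pi / 2 - atan 0 :> R by rewrite atan0 subr0.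
rewrite /Jint.
transitivity (\int[mu]_(s in `](0 : R), +oo[) (1 + s ^+ 2)^-1).
  by apply: eq_Rintegral => s _; rewrite powRr0 mul1r.
apply: (@Rintegral_FTCoy R (fun s : R => (1 + s ^+ 2)^-1) atan 0 (atan 0) (pi / 2)).
- by move=> x _; exact: continuous_1sqr.
- by apply: cvg_at_right_filter; exact: continuous_atan.
- exact: cvgy_atan.
- have := @integrable_mellin 0 (ltrN10 R) ltr01; apply: eq_integrable => // s _.
  by rewrite /= powRr0 mul1r.
Qed.

Lemma Jint_formula (a : R) : `|a| < 1 -> cos (a * (pi / 2)) * Jint a = pi / 2.
Proof. by move=> a1; rewrite cos_Jint_cst// Jint_0. Qed.

End mellin.

(** * The integrals of Taylor remainders against powers: values at 0, scaling and bounds *)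

Section power_kernel.
Context {R : realType}.
Notation mu := (@lebesgue_measure R).

(* Gamma (p + 1) * Aint n p f 0 is computed by writing Gamma (p + 1) u^-(p+1) as
   a Laplace integral: what remains are the Mellin integrals Jint. *)
Definition Aint (n : nat) (p f Y : R) :=
  \int[mu]_(u in `]Y, +oo[) (tcos n.+1 f u * u `^ (- (p + 1))).

Lemma cosDnpi n (x : R) : cos (x + n%:R * pi) = (-1) ^+ n * cos x.
Proof.
elim: n => [|n IH]; first by rewrite mul0r addr0 mul1r.
by rewrite -natr1 mulrDl mul1r addrA cosDpi IH exprS mulN1r mulNr.
Qed.

Lemma sinDnpi n (x : R) : sin (x + n%:R * pi) = (-1) ^+ n * sin x.
Proof.
elim: n => [|n IH]; first by rewrite mul0r addr0 mul1r.
by rewrite -natr1 mulrDl mul1r addrA sinDpi IH exprS mulN1r mulNr.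
Qed.

Section values.
Variables (n : nat) (p : R).
Hypotheses (np : n%:R < p) (pn : p < n.+1%:R).

Let q := p - n%:R.

Let q0 : 0 < q. Proof. by rewrite subr_gt0. Qed.

Let q1 : q < 1. Proof. by rewrite ltrBlDr addrC natr1. Qed.

Let p0 : 0 < p. Proof. exact: le_lt_trans np. Qed.

(** [Lap_at0] divides by s^(n+1), and p - (n+1) = q - 1. Both exponents q and q - 1 lie in ]-1, 1[,
    where the Mellin integrals converge. *)
Let Gamma_Aint0 f (psi := f + n.+1%:R * (pi / 2)) :
  Gamma (p + 1) * Aint n p f 0 = cos psi * Jint q - sin psi * Jint (q - 1).
Proof.
rewrite /Aint laplace_tcos// /Jint.
have i1 : mu.-integrable `]0, +oo[ (EFin \o (fun s : R => s `^ q / (1 + s ^+ 2))).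
  by apply: integrable_mellin; move: q0 q1; move: q => Q; lra.
have i2 : mu.-integrable `]0, +oo[ (EFin \o (fun s : R => s `^ (q - 1) / (1 + s ^+ 2))).
  by apply: integrable_mellin; move: q0 q1; move: q => Q; lra.
rewrite -!RintegralZl// -RintegralB//; last 2 first.
- exact: integrableZl_EFin.
- exact: integrableZl_EFin.
apply: eq_Rintegral => s; rewrite inE/= in_itv/= andbT => s0.
rewrite Lap_at0// -/psi.
have s1 : 1 + s ^+ 2 != 0 by rewrite gt_eqF// ltr_pwDl// sqr_ge0.
have sm : s ^+ n.+1 != 0 by rewrite expf_neq0// gt_eqF.
have -> : s `^ p = s `^ (q - 1) * s ^+ n.+1.
  rewrite -powR_mulrn ?(ltW s0)// -powRD ?(gt_eqF s0) ?implybT//.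
  by congr (_ `^ _); rewrite /q -natr1; ring.
have -> : s `^ q = s `^ (q - 1) * s.
  by rewrite -[X in _ * X]powRr1 ?(ltW s0)// -powRD ?(gt_eqF s0) ?implybT// subrK.
by move: (s ^+ n.+1) sm => S S0; field; rewrite S0 s1.
Qed.

Let cosq : cos (q * (pi / 2)) * Jint q = pi / 2.
Proof. by apply: Jint_formula; rewrite ltr_norml; apply/andP; split; move: q0 q1; move: q => Q; lra. Qed.

Let sinq : sin (q * (pi / 2)) * Jint (q - 1) = pi / 2.
Proof.
rewrite -cosBpihalf -{2}(mul1r (pi / 2)) -mulrBl.
by apply: Jint_formula; rewrite ltr_norml; apply/andP; split; move: q0 q1; move: q => Q; lra.
Qed.

(** The angle becomes -q pi / 2, so the two products, each pi / 2, add up. *)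
Lemma Gamma_Aint_plus : Gamma (p + 1) * Aint n p (- (pi * (p + 1) / 2)) 0 = pi.
Proof.
rewrite Gamma_Aint0.
have -> : - (pi * (p + 1) / 2) + n.+1%:R * (pi / 2) = - (q * (pi / 2)).
  by rewrite /q -natr1; field.
by rewrite cosN sinN cosq mulNr sinq opprK -splitr.
Qed.

(** Nonnegativity is clear, and a zero would contradict the preceding identity, whose right side is
    pi. *)
Lemma Gamma_gt0 : 0 < Gamma (p + 1).
Proof.
rewrite lt_def; apply/andP; split.
  by apply/eqP => G0; have := Gamma_Aint_plus; rewrite G0 mul0r => /esym/eqP; rewrite gt_eqF// pi_gt0.
by apply: Rintegral_ge0 => s _; rewrite mulr_ge0 ?powR_ge0 ?expR_ge0.
Qed.

(** Up to a multiple of pi the angle is q pi / 2, so the same two products cancel. *)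
Lemma Aint_minus0 : Aint n p (pi * (p + 1) / 2) 0 = 0.
Proof.
have G0 : Gamma (p + 1) != 0 by rewrite gt_eqF// Gamma_gt0.
apply: (mulfI G0); rewrite mulr0 Gamma_Aint0.
have -> : pi * (p + 1) / 2 + n.+1%:R * (pi / 2) = q * (pi / 2) + n.+1%:R * pi.
  by rewrite /q -natr1; field.
by rewrite cosDnpi sinDnpi -!mulrA cosq sinq subrr.
Qed.

Lemma Aint_scale f (x v : R) : 0 < x -> 0 < v ->
  \int[mu]_(t in `]v, +oo[) (tcos n.+1 f (t * x) * t `^ (- (p + 1))) =
  x `^ p * Aint n p f (x * v).
Proof.
move=> x0 v0; pose g u := tcos n.+1 f u * u `^ (- (p + 1)).
have xv0 : 0 < x * v by rewrite mulr_gt0.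
have cg u : 0 < u -> {for u, continuous g}.
  by move=> u0; apply: cvgM; [exact: continuous_tcos|exact: continuous_powR].
have cgw : {within `[x * v, +oo[, continuous g}.
  apply/continuous_within_itvcyP; split.
    by move=> u; rewrite in_itv/= andbT => xvu; apply: cg; exact: lt_trans xvu.
  by apply: cvg_at_right_filter; exact: cg.
have ig : mu.-integrable `]x * v, +oo[ (EFin \o g).
  by apply: integrable_tcos_powR => //; exact: ltW.
rewrite /Aint (Rintegral_scale x0 cgw ig) mulrA -RintegralZl//; last exact: integrable_scale.
apply: eq_Rintegral => t; rewrite inE/= in_itv/= andbT => vt.
have t0 : 0 < t by exact: lt_trans vt.
rewrite /g powRM ?(ltW x0) ?(ltW t0)// (mulrC t).
rewrite (_ : x `^ p * x * _ = tcos n.+1 f (x * t) * t `^ (- (p + 1)) * (x `^ p * x `^ 1 * x `^ (- (p + 1)))); last first.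
  by rewrite powRr1 ?(ltW x0)//; ring.
rewrite -!powRD ?(gt_eqF x0) ?implybT//.
by rewrite (_ : p + 1 + _ = 0) ?powRr0 ?mulr1//; ring.
Qed.

Lemma Aint_norm_le f Y : 0 < Y ->
  `|Aint n p f Y| <= 2 / (p - n%:R) * Y `^ (n%:R - p).
Proof.
move=> Y0; have iA := integrable_tcos_powR np pn f (ltW Y0).
apply: (@le_trans _ _ (\int[mu]_(u in `]Y, +oo[) `|tcos n.+1 f u * u `^ (- (p + 1))|)).
  exact: le_normr_Rintegral.
have r1 : n%:R - p - 1 < -1 by move: np => ?; lra.
have -> : 2 / (p - n%:R) * Y `^ (n%:R - p) =
   \int[mu]_(u in `]Y, +oo[) (2 * u `^ (n%:R - p - 1)).
  rewrite RintegralZl//; last exact: integrable_powR_oy.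
  by rewrite Rintegral_powR_oy// subrK opprB; ring.
apply: le_Rintegral => //.
- exact: integrable_abse iA.
- by apply: integrableZl_EFin => //; exact: integrable_powR_oy.
- by move=> u /=; rewrite in_itv/= andbT => Yu; apply: norm_tcos_powRy; exact: lt_trans Yu.
Qed.

Lemma Aint_split f (a b : R) : 0 <= a -> a <= b ->
  Aint n p f a = \int[mu]_(u in `]a, b]) (tcos n.+1 f u * u `^ (- (p + 1))) + Aint n p f b.
Proof.
move=> a0 ab; have iA := integrable_tcos_powR np pn f a0.
have U : `]a, +oo[%classic = `]a, b] `|` `]b, +oo[ :> set R.
  by rewrite -itv_bndbnd_setU ?bnd_simp.
rewrite /Aint U Rintegral_setU//; last exact: disj_itv_split.
by rewrite -U.
Qed.

(** Since the integral over ]0, oo[ is 0, the one over ]Y, oo[ is minus the one over ]0, Y], where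
    the bound of degree n + 1 is the good one. *)
Lemma Aint_norm_le0 (Y : R) : 0 < Y ->
  `|Aint n p (pi * (p + 1) / 2) Y| <= (n.+1%:R - p)^-1 * Y `^ (n.+1%:R - p).
Proof.
move=> Y0; have := Aint_split (pi * (p + 1) / 2) (lexx 0) (ltW Y0).
rewrite Aint_minus0 => /esym/eqP; rewrite addrC addr_eq0 => /eqP ->; rewrite normrN.
have iA : mu.-integrable `]0, Y] (EFin \o (fun u => tcos n.+1 (pi * (p + 1) / 2) u * u `^ (- (p + 1)))).
  apply: integrableS (integrable_tcos_powR np pn (pi * (p + 1) / 2) (lexx 0)) => //.
  exact: subset_itvl.
apply: (@le_trans _ _ (\int[mu]_(u in `]0, Y]) `|tcos n.+1 (pi * (p + 1) / 2) u * u `^ (- (p + 1))|)).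
  exact: le_normr_Rintegral.
have r1 : -1 < n%:R - p by move: pn; rewrite -natr1 => ?; lra.
have -> : (n.+1%:R - p)^-1 * Y `^ (n.+1%:R - p) = \int[mu]_(u in `]0, Y]) (u `^ (n%:R - p)).
  by rewrite Rintegral_powR_0c// -natr1 (addrAC n%:R) mulrC.
apply: le_Rintegral => //.
- exact: integrable_abse iA.
- exact: integrable_powR_0c.
- by move=> u /=; rewrite in_itv/= => /andP[u0 _]; exact: norm_tcos_powR0.
Qed.

Lemma Aint_cvg0 f : Aint n p f Y @[Y --> 0^'+] --> Aint n p f 0.
Proof.
apply/cvg_at_rightP => u [u0 ucvg]; apply: Rintegral_set_cvg => //.
- by move=> k; apply: subset_itvr; rewrite bnd_simp ltW.
- move=> x; rewrite /= in_itv/= andbT => x0.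
  have : \forall k \near \oo, u k < x by apply: (cvgr_lt 0).
  by apply: filterS => k ukx; rewrite /= in_itv/= ukx.
- exact: integrable_tcos_powR.
Qed.

Lemma Aint_bounded f : exists2 C, 0 <= C & forall Y, 0 <= Y -> `|Aint n p f Y| <= C.
Proof.
have iA := integrable_tcos_powR np pn f (lexx 0).
pose g u := `|tcos n.+1 f u * u `^ (- (p + 1))|.
have ig : mu.-integrable `]0, +oo[ (EFin \o g) := integrable_abse iA.
exists (\int[mu]_(u in `]0, +oo[) g u); first by apply: Rintegral_ge0 => u _; exact: normr_ge0.
move=> Y Y0; have iY := integrable_tcos_powR np pn f Y0.
apply: (@le_trans _ _ (\int[mu]_(u in `]Y, +oo[) g u)).
  exact: le_normr_Rintegral.
have sub : `]Y, +oo[ `<=` `](0 : R), +oo[ by apply: subset_itvr; rewrite bnd_simp.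
rewrite /Rintegral fine_le//.
- by apply: integrable_fin_num => //; exact: integrable_abse iY.
- exact: integrable_fin_num.
- apply: ge0_subset_integral => //; first by case/integrableP: ig.
  by move=> u _; rewrite lee_fin normr_ge0.
Qed.

End values.

(** * Sign and asymptotics of the kernel for n = 0 *)

Section positivity_base.
Variable q : R.
Hypotheses (q0 : 0 < q) (q1 : q < 1).

Let np : 0%:R < q. Proof. exact: q0. Qed.

Let pn : q < 1%:R. Proof. exact: q1. Qed.

Let phi := pi * (q + 1) / 2.

Let phiE : phi = q * (pi / 2) + pi / 2. Proof. by rewrite /phi; field. Qed.

Let qpi : 0 < q * (pi / 2) < pi / 2.
Proof.
have p0 : 0 < pi / 2 :> R by rewrite divr_gt0 ?pi_gt0.
by rewrite mulr_gt0//= gtr_pMl.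
Qed.

Let cphi : 0 < - cos phi.
Proof. by rewrite phiE cosDpihalf opprK sin_gt0_pihalf. Qed.

Let sphi : 0 < sin phi.
Proof.
rewrite phiE sinDpihalf cos_gt0_pihalf//.
by move: qpi => /andP[? ?]; apply/andP; split; lra.
Qed.

Let tcos1E u : tcos 1 phi u = cos (u + phi) - cos phi.
Proof. by rewrite tcosS tcos0E expr0 fact0 divr1 mul1r mul0r addr0. Qed.

Let per k (x : R) : cos (k%:R * (pi *+ 2) + x) = cos x /\ sin (k%:R * (pi *+ 2) + x) = sin x.
Proof.
rewrite addrC -[pi *+ 2]mulr_natl mulrA -natrM cosDnpi sinDnpi.
by rewrite mulnC exprM sqrrN !expr1n !mul1r.
Qed.

(* Passing from 0 to a multiple Y of the period multiplies the Laplace transform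
   by expR (- (Y * s)), which decreases in s, while the integrand h in s has
   integral 0 and changes sign once, from + to -. *)
Lemma Aint_ge0_period k : 0 <= Aint 0 q phi (k%:R * (pi *+ 2)).
Proof.
set Y := k%:R * _.
have Y0 : 0 <= Y by rewrite mulr_ge0// mulrn_wge0// pi_ge0.
have LapE Z : 0 <= Z -> (forall x, cos (Z + x) = cos x) -> (forall x, sin (Z + x) = sin x) ->
  forall s, 0 < s -> s `^ q * Lap 1 phi Z s =
    expR (- (Z * s)) * (s `^ (q - 1) / (1 + s ^+ 2) * (- cos phi - s * sin phi)).
  move=> Z0 Zc Zs s s0.
  have sn : s != 0 by rewrite gt_eqF.
  have s1 : 1 + s ^+ 2 != 0 by rewrite gt_eqF// ltr_pwDl// sqr_ge0.
  (* [Z] acts as a period, so [tcos 1 phi Z] is 0 and the boundary term drops. *)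
  have -> : Lap 1 phi Z s = Lap 0 (phi + pi / 2) Z s / s.
    apply: (mulfI sn); rewrite LapS// tcos1E Zc subrr mul0r add0r; by field.
  rewrite Lap0// Zc Zs cosDpihalf sinDpihalf.
  have -> : s `^ q = s `^ (q - 1) * s.
    by rewrite -[X in _ * X]powRr1 ?(ltW s0)// -powRD ?(gt_eqF s0) ?implybT// subrK.
  by field; rewrite s1 sn.
have Yc x : cos (Y + x) = cos x by case: (per k x).
have Ys x : sin (Y + x) = sin x by case: (per k x).
have G0 : 0 < Gamma (q + 1) by exact: (Gamma_gt0 np pn).
rewrite -(pmulr_rge0 _ G0) /Aint laplace_tcos//.
(* The value of expR (- (Y * s)) at the zero s = - cos phi / sin phi of [h]: then expR (- (Y * s)) *
   h s >= e * h s on both sides of it. *)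
pose e := expR (- (Y * (- cos phi / sin phi))).
pose h s := s `^ (q - 1) / (1 + s ^+ 2) * (- cos phi - s * sin phi).
have ih : mu.-integrable `]0, +oo[ (EFin \o h).
  have i1 : mu.-integrable `]0, +oo[ (EFin \o (fun s : R => s `^ q / (1 + s ^+ 2))).
    by apply: integrable_mellin; move: q0 q1 => *; lra.
  have i2 : mu.-integrable `]0, +oo[ (EFin \o (fun s : R => s `^ (q - 1) / (1 + s ^+ 2))).
    by apply: integrable_mellin; move: q0 q1 => *; lra.
  have i3 := @integrableZl_EFin R _ _ mu `]0, +oo[ (- cos phi) _ (measurable_itv _) i2.
  have i4 := @integrableZl_EFin R _ _ mu `]0, +oo[ (sin phi) _ (measurable_itv _) i1.
  have := @integrableB_EFin R _ _ mu `]0, +oo[ _ _ (measurable_itv _) i3 i4.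
  apply: eq_integrable => // s; rewrite inE/= in_itv/= andbT => s0.
  congr EFin; rewrite /h.
  have -> : s `^ q = s `^ (q - 1) * s.
    by rewrite -[X in _ * X]powRr1 ?(ltW s0)// -powRD ?(gt_eqF s0) ?implybT// subrK.
  by ring.
have h0 : \int[mu]_(s in `]0, +oo[) h s = 0.
  have := laplace_tcos np pn phi (lexx 0).
  rewrite -/(Aint 0 q phi 0) (Aint_minus0 np pn) mulr0 => {2}->.
  apply: eq_Rintegral => s; rewrite inE/= in_itv/= andbT => s0.
  by rewrite LapE// ?mul0r ?oppr0 ?expR0 ?mul1r// => x; rewrite add0r.
apply: (@le_trans _ _ (\int[mu]_(s in `]0, +oo[) (e * h s))).
  by rewrite RintegralZl// h0 mulr0.
have -> : \int[mu]_(s in `]0, +oo[) (s `^ q * Lap 1 phi Y s) =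
    \int[mu]_(s in `]0, +oo[) (expR (- (Y * s)) * h s).
  by apply: eq_Rintegral => s; rewrite inE/= in_itv/= andbT => s0; rewrite LapE.
apply: le_Rintegral => //.
- exact: integrableZl_EFin.
- apply: (@integrable_le_abs R _ _ mu _ _ (fun s => `|h s|)) => //.
  + apply: measurable_funM; last by apply/measurable_EFinP; case/integrableP : ih.
    apply: measurable_funTS; apply: measurableT_comp => //.
    by apply: measurableT_comp => //; exact: measurable_funM.
  + move=> s; rewrite /= in_itv/= andbT => s0; rewrite normrM ler_piMl//.
    by rewrite ger0_norm ?expR_ge0// -expR0 ler_expR oppr_le0 mulr_ge0// ltW.
  + exact: integrable_abse ih.
- move=> s; rewrite /= in_itv/= andbT => s0.
  have w0 : 0 <= s `^ (q - 1) / (1 + s ^+ 2).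
    by rewrite divr_ge0 ?powR_ge0// ltW// ltr_pwDl// sqr_ge0.
  rewrite /h mulrCA [leRHS]mulrCA; apply: ler_wpM2l => //.
  have [le|lt] := leP s (- cos phi / sin phi).
    apply: ler_wpM2r; first by rewrite subr_ge0 -ler_pdivlMr.
    by rewrite ler_expR lerN2 ler_wpM2l.
  rewrite -subr_ge0 -mulrBl mulr_le0// subr_le0.
    by rewrite ler_expR lerN2 ler_wpM2l// ltW.
  by rewrite -ler_pdivrMr// ltW.
Qed.

Let tcos1_sinsin u : tcos 1 phi u = - 2 * sin (u / 2 + phi) * sin (u / 2).
Proof.
rewrite tcos1E.
have -> : u + phi = (u / 2 + phi) + u / 2 by field.
have {2}-> : phi = (u / 2 + phi) - u / 2 by ring.
by rewrite !cosD cosN sinN; ring.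
Qed.

Let tcos1_per k u : tcos 1 phi (k%:R * (pi *+ 2) + u) = tcos 1 phi u.
Proof. by rewrite !tcos1E -addrA (per k _).1. Qed.

(* Over a period tcos 1 phi is first nonpositive and then nonnegative, so that
   Aint is bounded below by its value at one end of the period. *)
Lemma Aint_ge0 (Y : R) : 0 <= Y -> 0 <= Aint 0 q phi Y.
Proof.
move=> Y0; have p2 : 0 < pi *+ 2 :> R by rewrite mulrn_wgt0// pi_gt0.
have p1 : 0 < pi :> R by exact: pi_gt0.
pose k := Num.truncn (Y / (pi *+ 2)).
have /andP[kY Yk] : k%:R <= Y / (pi *+ 2) < k.+1%:R.
  by rewrite /k; apply: truncn_itv; rewrite divr_ge0// ltW.
rewrite ler_pdivlMr// in kY; rewrite ltr_pdivrMr// in Yk.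
set P := k%:R * (pi *+ 2) in kY.
have P0 : 0 <= P by rewrite mulr_ge0// ltW.
have Pk : k.+1%:R * (pi *+ 2) = P + pi *+ 2 by rewrite -natr1 mulrDl mul1r.
have phi1 : pi / 2 < phi < pi.
  by move: qpi => /andP[? ?]; rewrite phiE; apply/andP; split; lra.
(* At P + w, [tcos 1 phi] equals - 2 sin (w/2 + phi) sin (w/2); its first sine changes sign at w = 2
   (pi - phi). *)
have [Yc|cY] := leP (Y - P) (2 * (pi - phi)).
- have := Aint_ge0_period k; rewrite (Aint_split np pn phi P0 kY) -/P.
  suff : \int[mu]_(u in `]P, Y]) (tcos 1 phi u * u `^ (- (q + 1))) <= 0 by lra.
  rewrite -oppr_ge0 -[leRHS]mulN1r -RintegralZl//; last first.
    by apply: integrableS (integrable_tcos_powR np pn phi P0) => //; exact: subset_itvl.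
  apply: Rintegral_ge0 => u; rewrite /= in_itv/= => /andP[Pu uY].
  rewrite mulrA mulr_ge0 ?powR_ge0//.
  have -> : u = P + (u - P) by ring.
  rewrite tcos1_per tcos1_sinsin.
  rewrite [leRHS](_ : _ = 2 * (sin ((u - P) / 2 + phi) * sin ((u - P) / 2))); last by ring.
  rewrite mulr_ge0// mulr_ge0//.
    by apply: sin_ge0_pi; move: phi1 => /andP[? ?]; apply/andP; split; lra.
  by apply: sin_ge0_pi; move: phi1 => /andP[? ?]; apply/andP; split; lra.
- rewrite (Aint_split np pn phi Y0 (ltW Yk)) addr_ge0 ?Aint_ge0_period//.
  apply: Rintegral_ge0 => u; rewrite /= in_itv/= => /andP[Yu uP].
  rewrite mulr_ge0 ?powR_ge0//.
  have -> : u = P + (u - P) by ring.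
  rewrite tcos1_per tcos1_sinsin.
  rewrite Pk mulr2n in uP.
  have -> : (u - P) / 2 + phi = ((u - P) / 2 + phi - pi) + pi by ring.
  rewrite sinDpi [leRHS](_ : _ = 2 * (sin ((u - P) / 2 + phi - pi) * sin ((u - P) / 2))); last by ring.
  rewrite mulr_ge0// mulr_ge0//.
    by apply: sin_ge0_pi; move: phi1 => /andP[? ?]; apply/andP; split; lra.
  by apply: sin_ge0_pi; move: phi1 => /andP[? ?]; apply/andP; split; lra.
Qed.

Lemma cosphi_lt0 : 0 < - cos (pi * (q + 1) / 2).
Proof. exact: cphi. Qed.

(** The constant term - cos phi integrates to - cos phi / q times Y^-q, while the oscillating term
    gains a power by integration by parts. The 2 collects its boundary term and the remaining
    integral of [g], each at least - Y^-(q+1). *)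
Lemma Aint_lower (Y : R) : 0 < Y ->
  - cos phi / q - 2 / Y <= Y `^ q * Aint 0 q phi Y.
Proof.
move=> Y0; have Yn := ltW Y0; have iA := integrable_tcos_powR np pn phi Yn.
have cs : continuous (fun u : R => sin (u + phi)).
  move=> u.
  have d : has_derive u (fun u : R => sin (u + phi)) (cos (u + phi) * (1 + 0)).
    by apply: has_derive_fct_sin; apply: has_derive_fctD; [exact: has_derive_fct_id|exact: has_derive_fct_cst].
  exact: is_derive_continuous d.
pose g u := (q + 1) * (sin (u + phi) * u `^ (- (q + 1) - 1)).
have ig : mu.-integrable `]Y, +oo[ (EFin \o g).
  apply: integrableZl_EFin => //.
  apply: (@integrable_le_abs R _ _ mu _ _ (fun u : R => u `^ (- (q + 1) - 1))) => //.
  - apply: measurable_funTS; apply: measurable_funM; last exact: measurable_powR.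
    exact: continuous_measurable_fun.
  - by move=> u _; rewrite normrM [X in _ * X]ger0_norm ?powR_ge0// ler_piMl ?powR_ge0// sin_max.
  - by apply: integrable_powR_oy => //; move: q0 => ?; lra.
pose F u := sin (u + phi) * u `^ (- (q + 1)) + cos phi / q * u `^ (- q).
have cF (u : R) : 0 < u -> {for u, continuous F}.
  move=> u0; apply: cvgD.
    by apply: cvgM; [exact: cs|exact: continuous_powR].
  by apply: cvgM; [exact: cvg_cst|exact: continuous_powR].
have E : \int[mu]_(u in `]Y, +oo[) (tcos 1 phi u * u `^ (- (q + 1)) - g u) = 0 - F Y.
  apply: (@Rintegral_FTCoy R (fun u => tcos 1 phi u * u `^ (- (q + 1)) - g u) F Y (F Y) 0).
  - move=> u Yu; have u0 : 0 < u by exact: lt_trans Yu.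
    apply: cvgB; first by apply: cvgM; [exact: continuous_tcos|exact: continuous_powR].
    by apply: cvgM; [exact: cvg_cst|apply: cvgM; [exact: cs|exact: continuous_powR]].
  - move=> u Yu; have u0 : 0 < u by exact: lt_trans Yu.
    apply: has_derive_eq.
      apply: has_derive_fctD.
        apply: has_derive_fctM; last exact: (is_derive1_powR (- (q + 1)) u0).
        by apply: has_derive_fct_sin; apply: has_derive_fctD; [exact: has_derive_fct_id|exact: has_derive_fct_cst].
      by apply: has_derive_fctM; [exact: has_derive_fct_cst|exact: (is_derive1_powR (- q) u0)].
    rewrite /= /g tcos1E (_ : - q - 1 = - (q + 1)); last by ring.
    by field; rewrite gt_eqF.
  - by apply: cvg_at_right_filter; exact: cF.
  - rewrite -[X in _ --> X]addr0 -[X in _ --> _ + X](mulr0 (cos phi / q)).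
    apply: cvgD.
      apply: norm_cvg0; apply: (@squeeze_cvgr _ _ _ _ (cst 0) (fun u => u `^ (- (q + 1)))).
      + apply: nearW => u; rewrite normr_ge0/= normrM [X in _ * X]ger0_norm ?powR_ge0//.
        by rewrite ler_piMl ?powR_ge0// sin_max.
      + exact: cvg_cst.
      + by apply: powR_cvgy0; move: q0 => ?; lra.
    by apply: cvgM; [exact: cvg_cst|apply: powR_cvgy0; rewrite oppr_lt0].
  - exact: integrableB_EFin.
rewrite RintegralB// in E; rewrite -/(Aint 0 q phi Y) in E.
have Ig : - Y `^ (- (q + 1)) <= \int[mu]_(u in `]Y, +oo[) g u.
  have r1 : - (q + 1) - 1 < -1 by move: q0 => ?; lra.
  have -> : - Y `^ (- (q + 1)) = \int[mu]_(u in `]Y, +oo[) (- (q + 1) * u `^ (- (q + 1) - 1)).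
    rewrite RintegralZl//; last exact: integrable_powR_oy.
    rewrite Rintegral_powR_oy// subrK opprK; field.
    by move: q0 => ?; rewrite gt_eqF//; lra.
  apply: le_Rintegral => //; first by apply: integrableZl_EFin => //; exact: integrable_powR_oy.
  move=> u _; rewrite /g mulNr -mulrN; apply: ler_wpM2l; first by move: q0 => ?; lra.
  by rewrite -mulN1r; apply: ler_wpM2r; [exact: powR_ge0|exact: sin_geN1].
have s1 : sin (Y + phi) * Y `^ (- (q + 1)) <= Y `^ (- (q + 1)).
  by rewrite ler_piMl ?powR_ge0// sin_le1.
have low : - cos phi / q * Y `^ (- q) - 2 * Y `^ (- (q + 1)) <= Aint 0 q phi Y.
  by rewrite /F in E; move: E Ig s1; rewrite !mulNr; lra.
have Yq : 0 <= Y `^ q by exact: powR_ge0.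
apply: (le_trans _ (ler_wpM2l Yq low)).
rewrite mulrBr [Y `^ q * (_ * Y `^ (- q))]mulrCA [Y `^ q * (2 * _)]mulrCA -!powRD ?(gt_eqF Y0) ?implybT//.
rewrite subrr powRr0 mulr1 (_ : q - (q + 1) = -1); last by ring.
by rewrite powR_inv1.
Qed.

End positivity_base.

(** * Sign of the kernel for all n, by differentiation in y *)

Section positivity.
Variable q : R.
Hypotheses (q0 : 0 < q) (q1 : q < 1).

Let P (n : nat) := n%:R + q.

Let phi (n : nat) := pi * (P n + 1) / 2.

Let np n : n%:R < P n. Proof. by rewrite ltrDl. Qed.

Let pn n : P n < n.+1%:R. Proof. by rewrite -natr1 ltrD2l. Qed.

(* Scaling moves y into tcos under the integral, whence the derivative in y of
   Bker n.+1 (p + 1) is - Bker n p: signs and lower bounds propagate from n = 0. *)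
Definition Bker (n : nat) (p y : R) := y `^ p * Aint n p (pi * (p + 1) / 2) y.

Let kernel n (y t : R) := tcos n.+1 (phi n) (t * y) * t `^ (- (P n + 1)).

Let BkerE n y : 0 < y -> Bker n (P n) y = \int[mu]_(t in `]1, +oo[) kernel n y t.
Proof.
by move=> y0; rewrite (Aint_scale (np n) (pn n) _ y0 ltr01) mulr1.
Qed.

Lemma Bker_norm_le n p (y : R) : n%:R < p -> p < n.+1%:R -> 0 < y ->
  `|Bker n p y| <= 2 / (p - n%:R) * y ^+ n.
Proof.
move=> hp hp' y0; rewrite /Bker normrM ger0_norm ?powR_ge0//.
apply: (le_trans (ler_wpM2l (powR_ge0 _ _) (Aint_norm_le hp hp' _ y0))).
rewrite mulrCA -powRD ?(gt_eqF y0) ?implybT//.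
by rewrite addrCA subrr addr0 powR_mulrn// ltW.
Qed.

Lemma Bker_norm_le0 n p (y : R) : n%:R < p -> p < n.+1%:R -> 0 < y ->
  `|Bker n p y| <= (n.+1%:R - p)^-1 * y ^+ n.+1.
Proof.
move=> hp hp' y0; rewrite /Bker normrM ger0_norm ?powR_ge0//.
apply: (le_trans (ler_wpM2l (powR_ge0 _ _) (Aint_norm_le0 hp hp' y0))).
rewrite mulrCA -powRD ?(gt_eqF y0) ?implybT//.
by rewrite addrCA subrr addr0 powR_mulrn// ltW.
Qed.

Let integrable_kernel n y : 0 < y -> mu.-integrable `]1, +oo[ (EFin \o kernel n y).
Proof.
move=> y0; apply: (@integrable_le_abs R _ _ mu _ _ (fun t => 2 * y ^+ n * t `^ (n%:R - P n - 1))) => //.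
- apply: measurable_funTS; apply: measurable_funM; last exact: measurable_powR.
  apply: (measurableT_comp (measurable_tcos n.+1 (phi n))).
  exact: measurable_funM.
- move=> t; rewrite /= in_itv/= andbT => t1; have t0 : 0 < t by exact: lt_trans t1.
  rewrite /kernel normrM [X in _ * X]ger0_norm ?powR_ge0//.
  apply: (le_trans (ler_wpM2r (powR_ge0 _ _) (norm_tcosS _ _ _))).
    by rewrite mulr_ge0 ?ltW.
  rewrite exprMn -[t ^+ n]powR_mulrn ?(ltW t0)//.
  rewrite [leLHS](_ : _ = 2 * y ^+ n * (t `^ n%:R * t `^ (- (P n + 1)))); last by ring.
  by rewrite -powRD ?(gt_eqF t0) ?implybT// opprD addrA.
- apply: integrableZl_EFin => //; apply: integrable_powR_oy => //.
  by rewrite /P; move: q0 => ?; lra.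
Qed.

(** [phi n.+1] exceeds [phi n] by pi / 2 and differentiation adds another pi / 2: the shift by pi is
    the minus sign. The inner factor t lowers the exponent from [P n.+1] to [P n]. *)
Let is_derive_kernel n (y t : R) : 0 < t ->
  is_derive y 1 (fun y => kernel n.+1 y t) (- kernel n y t).
Proof.
move=> t0; apply: has_derive_eq.
  apply: has_derive_fctM; last exact: has_derive_fct_cst.
  have d := is_derive_tcos n.+1 (phi n.+1) (t * y).
  have l : has_derive y (fun y => t * y) (t * 1 + y * 0).
    by apply: has_derive_fctM; [exact: has_derive_fct_cst|exact: has_derive_fct_id].
  exact: (@is_derive1_comp _ (tcos n.+2 (phi n.+1)) (fun y => t * y) y _ _ d l).
rewrite /kernel /= mulr0 add0r mulr0 addr0 mulr1.
have -> : phi n.+1 + pi / 2 = phi n + pi by rewrite /phi /P -natr1; field.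
rewrite tcosDpi.
have -> : t `^ (- (P n + 1)) = t * t `^ (- (P n.+1 + 1)).
  rewrite -[X in _ = X * _]powRr1 ?(ltW t0)// -powRD ?(gt_eqF t0) ?implybT//.
  by congr (_ `^ _); rewrite /P -natr1; ring.
by ring.
Qed.

Lemma is_derive_Bker n (y : R) : 0 < y ->
  is_derive y 1 (Bker n.+1 (P n.+1)) (- Bker n (P n) y).
Proof.
move=> y0.
(* A bound, uniform for x in ]0, 2y[, on the derivative - kernel n x t, from the degree n estimate
   of the remainder. *)
pose G (t : R) := 2 * (2 * y) ^+ n * `|t| `^ (n%:R - P n - 1).
have Iy : `]0, 2 * y[%classic y.
  by rewrite /= in_itv/= y0/= ltr_pMl// ltr1n.
have dk x t : `]0, 2 * y[%classic x -> `]1, +oo[%classic t ->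
    is_derive x 1 (fun y => kernel n.+1 y t) (- kernel n x t).
  by rewrite /= !in_itv/= andbT => _ t1; apply: is_derive_kernel; exact: lt_trans t1.
have h1 x : `]0, 2 * y[%classic x -> mu.-integrable `]1, +oo[ (EFin \o kernel n.+1 x).
  by rewrite /= in_itv/= => /andP[x0 _]; exact: integrable_kernel.
have h2 x t : `]0, 2 * y[%classic x -> `]1, +oo[%classic t -> derivable (fun y => kernel n.+1 y t) x 1.
  by move=> hx ht; case: (dk x t hx ht).
have hG0 t : 0 <= G t by rewrite mulr_ge0 ?powR_ge0// mulr_ge0// exprn_ge0// mulr_ge0// ltW.
have hGi : mu.-integrable `]1, +oo[ (EFin \o G).
  have : mu.-integrable `]1, +oo[ (EFin \o (fun t : R => 2 * (2 * y) ^+ n * t `^ (n%:R - P n - 1))).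
    apply: integrableZl_EFin => //; apply: integrable_powR_oy => //.
    by rewrite /P; move: q0 => ?; lra.
  apply: eq_integrable => // t; rewrite inE/= in_itv/= andbT => t1.
  by rewrite /G ger0_norm// (ltW (lt_trans _ t1)).
have h3 x t : `]0, 2 * y[%classic x -> `]1, +oo[%classic t ->
    `|partial1of2 (kernel n.+1) x t| <= G t.
  move=> hx ht; rewrite partial1of2E; case: (dk x t hx ht) => _ ->.
  move: hx ht; rewrite /= !in_itv/= andbT => /andP[x0 x1] t1.
  have t0 : 0 < t by exact: lt_trans t1.
  rewrite normrN /kernel normrM [X in _ * X]ger0_norm ?powR_ge0//.
  apply: (le_trans (ler_wpM2r (powR_ge0 _ _) (norm_tcosS _ _ _))).
    by rewrite mulr_ge0 ?ltW.
  rewrite /G ger0_norm ?(ltW t0)// exprMn -[t ^+ n]powR_mulrn ?(ltW t0)//.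
  rewrite [leLHS](_ : _ = 2 * x ^+ n * (t `^ n%:R * t `^ (- (P n + 1)))); last by ring.
  rewrite -powRD ?(gt_eqF t0) ?implybT// opprD addrA.
  apply: ler_wpM2r; first exact: powR_ge0.
  by rewrite ler_pM2l// lerXn2r ?nnegrE ?mulr_ge0 ?(ltW x0) ?(ltW y0)// ltW.
have D1 := @derivable_under_integral R _ _ mu (kernel n.+1) `]1, +oo[ (measurable_itv _) y 0 (2 * y) Iy h1 h2 G hG0 hGi h3.
have D2 := @differentiation_under_integral R _ _ mu (kernel n.+1) `]1, +oo[ (measurable_itv _) y 0 (2 * y) Iy h1 h2 G hG0 hGi h3.
have nearE : {near y, (fun z => \int[mu]_(t in `]1, +oo[) kernel n.+1 z t) =1 Bker n.+1 (P n.+1)}.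
  near=> z; rewrite BkerE//; near: z; exact: lt_nbhsr.
apply: DeriveDef; first exact: near_eq_derivable D1.
rewrite -(near_eq_derive _ nearE)// -derive1E D2.
rewrite BkerE// -[RHS]mulN1r -RintegralZl//; last exact: integrable_kernel.
apply: eq_Rintegral => t; rewrite inE => ht.
by rewrite partial1of2E; case: (dk y t Iy ht) => _ ->; rewrite mulN1r.
Unshelve. all: end_near. Qed.

(** In the step, the function with its sign has derivative (-1)^n [Bker n] >= 0 and tends to 0 at 0,
    hence is nonnegative; beyond M this derivative is at least c. *)
Lemma Bker_sign n :
  (forall y, 0 < y -> 0 <= (-1) ^+ n * Bker n (P n) y) /\
  exists c M, [/\ 0 < c, 0 < M & forall y, M <= y -> c <= (-1) ^+ n * Bker n (P n) y].
Proof.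
elim: n => [|n [IH0 [c [M [c0 M0 IHc]]]]].
  have P0 : P 0 = q by rewrite /P add0r.
  rewrite P0; split.
    by move=> y y0; rewrite mul1r mulr_ge0 ?powR_ge0// Aint_ge0// ltW.
  set al := - cos (pi * (q + 1) / 2) / q.
  have al0 : 0 < al by rewrite divr_gt0// cosphi_lt0.
  (* [Aint_lower] bounds the kernel below by al - 2 / y, and 2 / y <= al / 2 once y >= 4 / al. *)
  exists (al / 2), (4 / al); split; [exact: divr_gt0|exact: divr_gt0|move=> y My].
  have y0 : 0 < y by rewrite (lt_le_trans _ My)// divr_gt0.
  rewrite mul1r; apply: le_trans (Aint_lower q0 q1 y0); rewrite -/al.
  suff : 2 / y <= al / 2 by lra.
  rewrite ler_pdivrMr//; move: My; rewrite ler_pdivrMr// => My.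
  by lra.
pose s : R := (-1) ^+ n.+1.
have dB (y : R) : 0 < y -> is_derive y 1 (fun z => s * Bker n.+1 (P n.+1) z) ((-1) ^+ n * Bker n (P n) y).
  move=> y0; apply: has_derive_eq.
    by apply: has_derive_fctM; [exact: has_derive_fct_cst|exact: is_derive_Bker].
  by rewrite /= mulr0 addr0 /s exprS; ring.
have mvt x y : 0 < x -> x < y -> exists2 z, x < z < y &
    s * Bker n.+1 (P n.+1) y - s * Bker n.+1 (P n.+1) x = (-1) ^+ n * Bker n (P n) z * (y - x).
  move=> x0 xy.
  have [||z zI E] := @MVT R (fun z => s * Bker n.+1 (P n.+1) z) (fun z => (-1) ^+ n * Bker n (P n) z) x y xy.
  - by move=> z; rewrite in_itv/= => /andP[xz _]; apply: dB; exact: lt_trans xz.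
  - apply: continuous_in_subspaceT => z /set_mem/=; rewrite in_itv/= => /andP[xz _].
    by apply: is_derive_continuous; apply: dB; exact: lt_le_trans xz.
  by exists z => //; move: zI; rewrite in_itv.
have pos y : 0 < y -> 0 <= s * Bker n.+1 (P n.+1) y.
  move=> y0; apply/ler_addgt0Pr => e e0.
  pose C := 2 / (P n.+1 - n.+1%:R).
  have C0 : 0 < C by rewrite divr_gt0// subr_gt0.
  (* A point below y where the kernel is at most e: x <= 1 reduces x^(n+1) to x, and x <= e / C
     concludes. *)
  pose x := Num.min (Num.min (y / 2) 1) (e / C).
  have x0 : 0 < x by rewrite !lt_min ltr01 andbT; apply/andP; split; exact: divr_gt0.
  have x1 : x <= 1 by rewrite /x !ge_min lexx orbT.
  have xe : x <= e / C by rewrite /x !ge_min lexx !orbT.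
  have x2 : x <= y / 2 by rewrite /x !ge_min lexx.
  have xy : x < y by move: y0 x2 => *; lra.
  have [z /andP[xz zy] E] := mvt x y x0 xy.
  have z0 : 0 < z by exact: lt_trans xz.
  have : 0 <= (-1) ^+ n * Bker n (P n) z * (y - x) by rewrite mulr_ge0 ?IH0// subr_ge0 ltW.
  have : `|s * Bker n.+1 (P n.+1) x| <= e.
    rewrite normrM normrX normrN1 expr1n mul1r.
    apply: (le_trans (Bker_norm_le (np _) (pn _) x0)).
    apply: (@le_trans _ _ (C * x)); last by rewrite mulrC -ler_pdivlMr.
    rewrite -/C ler_pM2l// exprS ler_piMr ?(ltW x0)//.
    by apply: exprn_ile1 => //; exact: ltW.
  by rewrite ler_norml => /andP[]; move: E => + *; lra.
(* A length of at least 1 past M lets the function grow by at least c. *)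
split => //; exists c, (M + 1); split; [by []|exact: addr_gt0|move=> y My].
have My' : M < y by move: My => ?; lra.
have [z /andP[Mz zy] E] := mvt M y M0 My'.
have b1 : c <= (-1) ^+ n * Bker n (P n) z by apply: IHc; exact: ltW.
have b2 := pos M M0.
have b3 : c <= (-1) ^+ n * Bker n (P n) z * (y - M).
  by rewrite (le_trans b1)// ler_peMr ?(le_trans (ltW c0))//; move: My => ?; lra.
by move: E b2 b3; rewrite -/s; lra.
Qed.

End positivity.

End power_kernel.

(** * From the complex integrand to real Taylor remainders *)

Section complex_phase.
Context {R : realType}.
Local Open Scope complex_scope.

(** The subtraction formula for the cosine, applied to every Taylor term. The phases 0 and - pi / 2
    give the real and imaginary parts of e^(ix) minus its Taylor polynomial. *)
Lemma tcos_phase n (f x : R) :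
  tcos n (- f) x = cos f * tcos n 0 x + sin f * tcos n (- (pi / 2)) x.
Proof.
have key (y : R) : cos (y - f) = cos f * cos y + sin f * cos (y - pi / 2).
  by rewrite cosBpihalf cosD cosN sinN; ring.
elim: n => [|n IH]; first by rewrite !tcos0E key addr0.
rewrite !tcosS IH addrC.
have -> : cos (- f + n%:R * (pi / 2)) =
  cos f * cos (0 + n%:R * (pi / 2)) + sin f * cos (- (pi / 2) + n%:R * (pi / 2)).
  by rewrite !(addrC _ (n%:R * _)) key addr0.
by ring.
Qed.

(** i^j is e^(i j pi / 2); its sine is written as a cosine of phase - pi / 2, to match the
    coefficients of [tcos]. *)
Lemma iX_expn (x : R) j : (0 +i* x) ^+ j =
  (x ^+ j * cos (0 + j%:R * (pi / 2))) +i* (x ^+ j * cos (- (pi / 2) + j%:R * (pi / 2))).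
Proof.
elim: j => [|j IH].
  by rewrite !expr0 !mul1r !mul0r !addr0 cos0 cosN cos_pihalf.
rewrite exprS IH; apply/eqP; rewrite eq_complex /= !mul0r.
have -> : 0 + j.+1%:R * (pi / 2) = 0 + j%:R * (pi / 2) + pi / 2 :> R.
  by rewrite -natr1; ring.
have -> : - (pi / 2) + j.+1%:R * (pi / 2) = 0 + j%:R * (pi / 2) :> R.
  by rewrite -natr1; ring.
have -> : - (pi / 2) + j%:R * (pi / 2) = 0 + j%:R * (pi / 2) - pi / 2 :> R by ring.
rewrite cosBpihalf cosDpihalf sub0r add0r exprS; apply/andP; split; apply/eqP; ring.
Qed.

Lemma e_ellE n (x : R) : e_ell n (0 +i* x) = tcos n.+1 0 x +i* tcos n.+1 (- (pi / 2)) x.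
Proof.
rewrite /e_ell /cexp /=.
have E m : (expR 0)%:C * (cos x +i* sin x) - \sum_(j < m) (0 +i* x) ^+ j / (j`!)%:R =
    tcos m 0 x +i* tcos m (- (pi / 2)) x.
  elim: m => [|m IH].
    by rewrite big_ord0 subr0 !tcos0E addr0 cosBpihalf expR0 mul1r.
  rewrite big_ord_recr/= opprD addrA IH !tcosS iX_expn.
  have -> : ((m`!)%:R : R[i]) = ((m`!)%:R : R)%:C by rewrite rmorph_nat.
  rewrite -fmorphV; apply/eqP; rewrite eq_complex /= !mulr0 subr0 add0r.
  by apply/andP; split; apply/eqP; ring.
exact: E.
Qed.

Lemma Re_div_itpow (a b t s : R) : 0 < t ->
  complex.Re ((a +i* b) / itpow t s) =
  (cos (pi * s / 2) * a + sin (pi * s / 2) * b) * t `^ (- s).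
Proof.
move=> t0; set th := pi * s / 2.
have -> : (itpow t s)^-1 = (t `^ (- s) * cos th) +i* (- (t `^ (- s) * sin th)).
  have tt : t `^ s * t `^ (- s) = 1.
    by rewrite -powRD ?(gt_eqF t0) ?implybT// subrr powRr0.
  have cs := cos2Dsin2 th.
  apply: mulr1_eq; apply/eqP; rewrite /itpow /cexp eq_complex /= expR0 -/th.
  apply/andP; split; apply/eqP.
    rewrite [LHS](_ : _ = (t `^ s * t `^ (- s)) * (cos th ^+ 2 + sin th ^+ 2)); last by ring.
    by rewrite tt cs mul1r.
  by ring.
by rewrite /=; ring.
Qed.

End complex_phase.

(** The ceiling gives p <= ell p + 1, and equality would make p an integer. *)
Lemma ell_itv (R : realType) (p : R) : 0 < p -> ~ (exists n : nat, p = n%:R) ->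
  (ell p)%:R < p /\ p < (ell p).+1%:R.
Proof.
move=> p0 pn; have c0 : 0 <= Num.ceil (p - 1) by rewrite ceil_ge0 ltrBrDl addrN.
have E : ((ell p)%:R : R) = (Num.ceil (p - 1))%:~R.
  by rewrite /ell -[in RHS](gez0_abs c0).
have /andP[h1 h2] := ceil_itv (p - 1).
rewrite -E in h2; rewrite intrB -E in h1.
split; first by rewrite -(ltrD2r (- 1)).
rewrite lt_neqAle; apply/andP; split.
  by apply/eqP => pE; apply: pn; exists (ell p).+1.
by rewrite -natr1 -lerBlDr.
Qed.

(** * Exchange of expectation and integral, and the formula for the truncated integral *)

Section random_variable.
Context d (T : measurableType d) (R : realType) (P : probability T R).
Notation mu := (@lebesgue_measure R).
Variables (n : nat) (p : R).
Hypotheses (np : n%:R < p) (pn : p < n.+1%:R).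

Let p0 : 0 < p. Proof. exact: le_lt_trans np. Qed.

Section nonneg.
Variable Y : T -> R.
Hypothesis mY : measurable_fun setT Y.
Hypothesis Y0 : forall w, 0 <= Y w.
Hypothesis iY : P.-integrable setT (EFin \o (fun w => Y w ^+ n)).

Let F f (z : R * T) := tcos n.+1 f (z.1 * Y z.2) * z.1 `^ (- (p + 1)).

Let mF f : measurable_fun setT (F f).
Proof.
apply: measurable_funM.
  apply: (measurableT_comp (measurable_tcos n.+1 f)).
  apply: measurable_funM; first exact: measurable_fst.
  exact: (measurableT_comp mY measurable_snd).
exact: (measurableT_comp (measurable_powR _) measurable_fst).
Qed.

Let M := fine (\int[P]_w (Y w ^+ n)%:E).

Let F_bound f t w : 0 < t -> `|F f (t, w)| <= 2 * t `^ (n%:R - p - 1) * Y w ^+ n.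
Proof.
move=> t0; rewrite /F /= normrM [X in _ * X]ger0_norm ?powR_ge0//.
apply: (le_trans (ler_wpM2r (powR_ge0 _ _) (norm_tcosS _ _ _))).
  by rewrite mulr_ge0// ltW.
rewrite exprMn -[t ^+ n]powR_mulrn ?(ltW t0)//.
rewrite [leLHS](_ : _ = 2 * (t `^ n%:R * t `^ (- (p + 1))) * Y w ^+ n); last by ring.
by rewrite -powRD ?(gt_eqF t0) ?implybT// opprD addrA.
Qed.

Lemma integrable_tcos_RV f t : 0 < t ->
  P.-integrable setT (EFin \o (fun w => tcos n.+1 f (t * Y w))).
Proof.
move=> t0; apply: (@integrable_le_abs R _ _ P _ _ (fun w => 2 * t ^+ n * Y w ^+ n)) => //.
- apply: (measurableT_comp (measurable_tcos n.+1 f)).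
  exact: measurable_funM.
- by move=> w _; rewrite -mulrA -exprMn norm_tcosS// mulr_ge0// ltW.
- exact: integrableZl_EFin.
Qed.

Let itv_sub (v : R) : 0 < v -> `[v, +oo[%classic `<=` `](v / 2), +oo[%classic.
Proof. by move=> v0; apply: subset_itvr; rewrite bnd_simp; lra. Qed.

(** The bound 2 t^(n-p-1) Y^n has an exponent of t below -1, integrable at infinity but not at 0:
    this is where the cut at v enters. *)
Let fin1 f v : 0 < v ->
  (\int[mu]_(t in `[v, +oo[) \int[P]_w `|F f (t, w)|%:E < +oo)%E.
Proof.
move=> v0; apply: (@le_lt_trans _ _ (\int[mu]_(t in `[v, +oo[) (2 * M * t `^ (n%:R - p - 1))%:E)%E).
  apply: ge0_le_integral => //.
  - by move=> t _; apply: integral_ge0 => w _; rewrite lee_fin.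
  - apply: measurable_funTS.
    have := @measurable_fun_fubini_tonelli_F _ _ _ _ R P (fun z => `|F f z|%:E).
    by apply => //; apply/measurable_EFinP; apply: measurableT_comp => //; exact: mF.
  - apply/measurable_EFinP; apply: measurable_funTS; exact: measurable_funM.
  - move=> t; rewrite /= in_itv/= andbT => vt; have t0 : 0 < t by exact: lt_le_trans vt.
    apply: (@le_trans _ _ (\int[P]_w (2 * t `^ (n%:R - p - 1) * Y w ^+ n)%:E)%E).
      apply: ge0_le_integral => //.
      + apply/measurable_EFinP; apply: measurableT_comp => //.
        by apply: (measurableT_comp (mF f)); exact: measurable_pair1.
      + apply/measurable_EFinP; apply: measurable_funM => //.
        exact: measurable_funX.
      + by move=> w _; rewrite lee_fin F_bound.
    under eq_integral do rewrite EFinM.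
    rewrite integralZl//= -[X in (_ * X)%E]fineK; last exact: integrable_fin_num.
    by rewrite -EFinM lee_fin -/M mulrAC.
apply: integrable_lty => //.
apply: (@integrableS _ _ _ mu `](v / 2), +oo[) => //; first exact: itv_sub.
apply: (@integrableZl_EFin R _ _ mu _ (2 * M)) => //.
by apply: integrable_powR_oy; [rewrite divr_gt0|move: np => ?; lra].
Qed.

Lemma tcos_RV_Fubini f v : 0 < v ->
  [/\ mu.-integrable `[v, +oo[ (EFin \o (fun t => fine (\int[P]_w (tcos n.+1 f (t * Y w))%:E) * t `^ (- (p + 1)))),
    P.-integrable setT (EFin \o (fun w => Y w `^ p * Aint n p f (Y w * v))) &
    \int[mu]_(t in `[v, +oo[) (fine (\int[P]_w (tcos n.+1 f (t * Y w))%:E) * t `^ (- (p + 1))) =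
    \int[P]_w (Y w `^ p * Aint n p f (Y w * v))].
Proof.
move=> v0.
have [] := @Rintegral_Fubini R _ _ _ _ mu P `[v, +oo[ setT (F f) (measurable_itv _) measurableT (mF f) (fin1 f v0).
have E1 t : t \in `[v, +oo[%classic -> (\int[P]_w (F f (t, w))%:E =
    (fine (\int[P]_w (tcos n.+1 f (t * Y w))%:E) * t `^ (- (p + 1)))%:E)%E.
  rewrite inE/= in_itv/= andbT => vt; have t0 : 0 < t by exact: lt_le_trans vt.
  have i := integrable_tcos_RV f t0.
  rewrite EFinM fineK; last exact: integrable_fin_num.
  rewrite muleC -integralZl//; apply: eq_integral => w _.
  by rewrite /F/= mulrC EFinM.
have E2 w : (\int[mu]_(t in `[v, +oo[) (F f (t, w))%:E =
    (Y w `^ p * Aint n p f (Y w * v))%:E)%E.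
  (* The scaling needs Y > 0; at Y = 0 both sides vanish, the right one because 0^p = 0 for p >
     0. *)
  have := Y0 w; rewrite le_eqVlt => /predU1P[Yw|Yw].
    rewrite -Yw powR0 ?gt_eqF// mul0r; apply: integral0_eq => t _.
    by rewrite /F/= -Yw mulr0 tcosS_0 mul0r.
  rewrite -(Aint_scale np pn _ Yw v0) -integral_itv_obnd_cbnd; last first.
    apply/measurable_EFinP; apply: measurable_funTS.
    by apply: (measurableT_comp (mF f)); exact: measurable_pair2.
  rewrite fineK//; apply: integrable_fin_num => //.
  have := integrable_tcos_powR np pn f (ltW (mulr_gt0 Yw v0)).
  move=> i; have c : {within `[Y w * v, +oo[, continuous (fun u => tcos n.+1 f u * u `^ (- (p + 1)))}.
    have cg u : 0 < u -> {for u, continuous (fun u => tcos n.+1 f u * u `^ (- (p + 1)))}.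
      by move=> u0; apply: cvgM; [exact: continuous_tcos|exact: continuous_powR].
    apply/continuous_within_itvcyP; split.
      by move=> u; rewrite in_itv/= andbT => xvu; apply: cg; apply: lt_trans xvu; exact: mulr_gt0.
    by apply: cvg_at_right_filter; apply: cg; exact: mulr_gt0.
  have := @integrableZl_EFin R _ _ mu `]v, +oo[ (Y w `^ (p + 1)) _ (measurable_itv _) (integrable_scale Yw c i).
  apply: eq_integrable => // t; rewrite inE/= in_itv/= andbT => vt.
  have t0 : 0 < t by exact: lt_trans vt.
  rewrite /F/= powRM ?(ltW Yw) ?(ltW t0)// (mulrC t).
  congr EFin; rewrite (_ : _ * _ = tcos n.+1 f (Y w * t) * t `^ (- (p + 1)) * (Y w `^ (p + 1) * Y w `^ (- (p + 1)))); last by ring.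
  by rewrite -powRD ?(gt_eqF Yw) ?implybT// subrr powRr0 mulr1.
move=> h1 h2 h3; split.
- by apply: eq_integrable h1 => // t tv; rewrite E1.
- by apply: eq_integrable h2 => // w _; rewrite E2.
- rewrite /Rintegral; congr fine.
  transitivity (\int[mu]_(t in `[v, +oo[) \int[P]_w (F f (t, w))%:E)%E.
    by apply: eq_integral => t tv; rewrite E1.
  by rewrite h3; apply: eq_integral => w _; rewrite E2.
Qed.

Lemma Rintegral_powR_Aint_cvg f : P.-integrable setT (EFin \o (fun w => Y w `^ p)) ->
  \int[P]_w (Y w `^ p * Aint n p f (Y w * v)) @[v --> 0^'+] -->
  Aint n p f 0 * \int[P]_w (Y w `^ p).
Proof.
move=> iYp; apply/cvg_at_rightP => u [u0 uc].
have [C C0 bC] := Aint_bounded np pn f.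
have i k : P.-integrable setT (EFin \o (fun w => Y w `^ p * Aint n p f (Y w * u k))).
  by have [] := tcos_RV_Fubini f (u0 k).
rewrite -RintegralZl//.
have [] := @dominated_convergence _ _ _ P setT measurableT
  (fun k w => (Y w `^ p * Aint n p f (Y w * u k))%:E)
  (fun w => (Aint n p f 0 * Y w `^ p)%:E) (fun w => (C * Y w `^ p)%:E).
- by move=> k; exact: measurable_int (i k).
- exact: measurable_int (@integrableZl_EFin R _ _ P _ (Aint n p f 0) _ measurableT iYp).
- apply/aeW => w _; apply: cvg_EFin; first exact: nearW.
  rewrite [X in X @ _ --> _](_ : _ = fun k => Y w `^ p * Aint n p f (Y w * u k))//.
  rewrite mulrC; apply: cvgM; first exact: cvg_cst.
  have := Y0 w; rewrite le_eqVlt => /predU1P[<-|Yw].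
    by under eq_fun do rewrite mul0r; exact: cvg_cst.
  move/cvg_at_rightP: (@Aint_cvg0 R n p np pn f); apply; split.
    by move=> k; exact: mulr_gt0.
  by rewrite -[X in _ --> X](mulr0 (Y w)); apply: cvgM => //; exact: cvg_cst.
- exact: integrableZl_EFin.
- apply/aeW => w k _; rewrite /= lee_fin normrM ger0_norm ?powR_ge0// mulrC.
  by rewrite ler_wpM2r ?powR_ge0// bC// mulr_ge0// ltW.
move=> _ _ c; rewrite /Rintegral; apply: fine_cvg; rewrite fineK//.
apply: integrable_fin_num => //.
exact: (@integrableZl_EFin R _ _ P _ (Aint n p f 0) _ measurableT iYp).
Qed.

Let Bker_scale v w : 0 < v -> Bker n p (v * Y w) =
  v `^ p * (Y w `^ p * Aint n p (pi * (p + 1) / 2) (Y w * v)).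
Proof. by move=> v0; rewrite /Bker powRM ?(ltW v0)// mulrA (mulrC v (Y w)). Qed.

Lemma integrable_Bker v : 0 < v -> P.-integrable setT (EFin \o (fun w => Bker n p (v * Y w))).
Proof.
move=> v0; have [_ i _] := tcos_RV_Fubini (pi * (p + 1) / 2) v0.
have := @integrableZl_EFin R _ _ P _ (v `^ p) _ measurableT i.
by apply: eq_integrable => // w _; rewrite /= Bker_scale.
Qed.

Lemma Rintegral_powR_Aint_Bker v : 0 < v ->
  \int[P]_w (Y w `^ p * Aint n p (pi * (p + 1) / 2) (Y w * v)) =
  v `^ (- p) * \int[P]_w Bker n p (v * Y w).
Proof.
move=> v0; have [_ i _] := tcos_RV_Fubini (pi * (p + 1) / 2) v0.
have -> : \int[P]_w Bker n p (v * Y w) =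
    \int[P]_w (v `^ p * (Y w `^ p * Aint n p (pi * (p + 1) / 2) (Y w * v))).
  by apply: eq_Rintegral => w _; rewrite Bker_scale.
by rewrite RintegralZl// mulrA -powRD ?(gt_eqF v0) ?implybT// addNr powRr0 mul1r.
Qed.

End nonneg.

Section real_RV.
Variable X : T -> R.
Hypothesis mX : measurable_fun setT X.
Hypothesis iX : P.-integrable setT (EFin \o (fun w => `|X w| ^+ n)).
Let Z w := Num.max (X w) 0.
Let Y w := Num.max (- X w) 0.
Let phi := pi * (p + 1) / 2 : R.

Let mZ : measurable_fun setT Z.
Proof. exact: measurable_maxr. Qed.

Let mY : measurable_fun setT Y.
Proof. by apply: measurable_maxr => //; exact: measurableT_comp. Qed.

Let Z0 w : 0 <= Z w. Proof. by rewrite /Z le_max lexx orbT. Qed.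

Let Y0 w : 0 <= Y w. Proof. by rewrite /Y le_max lexx orbT. Qed.

Let iZ : P.-integrable setT (EFin \o (fun w => Z w ^+ n)).
Proof.
apply: (@integrable_le_abs R _ _ P _ _ (fun w => `|X w| ^+ n)) => //.
  exact: measurable_funX.
move=> w _; rewrite normrX lerXn2r ?nnegrE// ger0_norm// /Z ge_max normr_ge0 andbT.
exact: ler_norm.
Qed.

Let iY : P.-integrable setT (EFin \o (fun w => Y w ^+ n)).
Proof.
apply: (@integrable_le_abs R _ _ P _ _ (fun w => `|X w| ^+ n)) => //.
  exact: measurable_funX.
move=> w _; rewrite normrX lerXn2r ?nnegrE// ger0_norm// /Y ge_max normr_ge0 andbT.
by rewrite -normrN; exact: ler_norm.
Qed.

Let tcosX f t w : 0 < t -> tcos n.+1 f (t * X w) =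
  tcos n.+1 f (t * Z w) + tcos n.+1 (- f) (t * Y w).
Proof. by move=> t0; rewrite tcos_split// ltW. Qed.

Let itcosX f t : 0 < t -> P.-integrable setT (EFin \o (fun w => tcos n.+1 f (t * X w))).
Proof.
move=> t0.
have := integrableD measurableT (integrable_tcos_RV mZ Z0 iZ f t0)
  (integrable_tcos_RV mY Y0 iY (- f) t0).
by apply: eq_integrable => // w _; rewrite /= tcosX.
Qed.

Lemma integrandE t : n = ell p -> 0 < t -> integrand P X p t =
  fine (\int[P]_w (tcos n.+1 (- phi) (t * Z w))%:E) * t `^ (- (p + 1)) +
  fine (\int[P]_w (tcos n.+1 phi (t * Y w))%:E) * t `^ (- (p + 1)).
Proof.
move=> nE t0; rewrite /integrand /cexpect -nE Re_div_itpow// -/phi -mulrDl; congr (_ * _).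
have EE (g h : T -> R) : (forall w, g w = h w) -> fine 'E_P[g] = \int[P]_w h w.
  by move=> gh; rewrite unlock; apply: eq_Rintegral => w _; exact: gh.
rewrite (EE _ (fun w => tcos n.+1 0 (t * X w))); last by move=> w; rewrite e_ellE.
rewrite (EE _ (fun w => tcos n.+1 (- (pi / 2)) (t * X w))); last by move=> w; rewrite e_ellE.
rewrite -!RintegralZl//; try exact: itcosX.
rewrite -RintegralD//; try by apply: integrableZl_EFin => //; exact: itcosX.
transitivity (\int[P]_w (tcos n.+1 (- phi) (t * Z w) + tcos n.+1 phi (t * Y w))).
  by apply: eq_Rintegral => w _; rewrite -tcos_phase tcosX// opprK.
by rewrite RintegralD//; exact: integrable_tcos_RV.
Qed.

(** The formula from which both implications are read; v^-p appears when Y^p Aint(Y v) is rewritten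
    through the kernel at v Y. *)
Lemma integrand_integral v : n = ell p -> 0 < v ->
  mu.-integrable `[v, +oo[ (EFin \o integrand P X p) /\
  \int[mu]_(t in `[v, +oo[) integrand P X p t =
  \int[P]_w (Z w `^ p * Aint n p (- phi) (Z w * v)) +
  v `^ (- p) * \int[P]_w Bker n p (v * Y w).
Proof.
move=> nE v0.
have [i1 _ e1] := tcos_RV_Fubini mZ Z0 iZ (- phi) v0.
have [i2 _ e2] := tcos_RV_Fubini mY Y0 iY phi v0.
have E t : t \in `[v, +oo[%classic -> integrand P X p t =
  fine (\int[P]_w (tcos n.+1 (- phi) (t * Z w))%:E) * t `^ (- (p + 1)) +
  fine (\int[P]_w (tcos n.+1 phi (t * Y w))%:E) * t `^ (- (p + 1)).
  by rewrite inE/= in_itv/= andbT => vt; apply: integrandE => //; exact: lt_le_trans vt.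
split.
  apply: (@eq_integrable _ _ _ mu _ _
    (fun t => (fine (\int[P]_w (tcos n.+1 (- phi) (t * Z w))%:E) * t `^ (- (p + 1)))%:E +
      (fine (\int[P]_w (tcos n.+1 phi (t * Y w))%:E) * t `^ (- (p + 1)))%:E)%E) => //.
    by move=> t tv; rewrite /= E.
  exact: integrableD.
have <- := Rintegral_powR_Aint_Bker mY Y0 iY v0.
rewrite -e1 -e2 -RintegralD//.
by apply: eq_Rintegral => t tv; rewrite E.
Qed.

End real_RV.

End random_variable.

(** * Tail of the negative part and expectation of the kernel *)

Section tail.
Context d (T : measurableType d) (R : realType) (P : probability T R).
Notation mu := (@lebesgue_measure R).
Variables (n : nat) (p : R).
Hypotheses (np : n%:R < p) (pn : p < n.+1%:R).

Let p0 : 0 < p. Proof. exact: le_lt_trans np. Qed.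

Let m (y : R) := Num.min (y ^+ n) (y ^+ n.+1).

Let m_ge0 y : 0 <= y -> 0 <= m y.
Proof. by move=> y0; rewrite /m le_min !exprn_ge0. Qed.

Lemma Bker0 : Bker n p 0 = 0.
Proof. by rewrite /Bker powR0 ?mul0r// gt_eqF. Qed.

Lemma Bker_norm_le_min y : 0 <= y ->
  `|Bker n p y| <= (2 / (p - n%:R) + (n.+1%:R - p)^-1) * m y.
Proof.
move=> y0; have a0 : 0 <= 2 / (p - n%:R) by rewrite divr_ge0// subr_ge0 ltW.
have b0 : 0 <= (n.+1%:R - p)^-1 by rewrite invr_ge0 subr_ge0 ltW.
move: y0; rewrite le_eqVlt => /predU1P[<-|y0].
  by rewrite Bker0 normr0 mulr_ge0 ?addr_ge0// m_ge0.
rewrite /m minEle; case: ifP => _.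
  apply: (le_trans (Bker_norm_le np pn y0)).
  by rewrite ler_wpM2r ?exprn_ge0 ?(ltW y0)// lerDl.
apply: (le_trans (Bker_norm_le0 np pn y0)).
by rewrite ler_wpM2r ?exprn_ge0 ?(ltW y0)// lerDr.
Qed.

Lemma lt_root (k : nat) (s y : R) : (0 < k)%N -> 0 < s -> 0 <= y ->
  s < y ^+ k -> s `^ k%:R^-1 < y.
Proof.
move=> k0 s0 y0; rewrite !ltNge; apply: contra => ys.
apply: (@le_trans _ _ ((s `^ k%:R^-1) ^+ k)).
  by rewrite lerXn2r ?nnegrE ?powR_ge0.
rewrite -powR_mulrn ?powR_ge0// -powRrM mulVf ?powRr1 ?(ltW s0)//.
by rewrite pnatr_eq0 -lt0n.
Qed.

(* For n = 0 the minimum never exceeds 1 and any exponent above 1 / p would do. *)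
Let e := if n is 0%N then 2 / p else n%:R^-1.

Lemma lt_min_root s y : 1 < s -> 0 <= y -> s < m y -> s `^ e < y.
Proof.
move=> s1 y0; rewrite /m /e lt_min; case: (n) => [|k] /andP[h _].
  by move: (lt_trans s1 h); rewrite expr0 ltxx.
by apply: lt_root => //; exact: lt_trans s1.
Qed.

Lemma e_gt1 a : p <= a -> 1 < a * e.
Proof.
rewrite /e; move: np; case: (n) => [_|k kp] pa.
  by rewrite mulrCA; apply: (@lt_le_trans _ _ 2); [lra|rewrite ler_pMr// ler_pdivlMr// mul1r].
by rewrite ltr_pdivlMr// mul1r; exact: lt_le_trans pa.
Qed.

Section nonneg.
Variable Y : T -> R.
Hypothesis mY : measurable_fun setT Y.
Hypothesis Y0 : forall w, 0 <= Y w.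

Let G x := fine (P [set w | Y w > x]).

Let mG x : measurable [set w | Y w > x].
Proof.
have := mY measurableT (measurable_itv `]x, +oo[); rewrite setTI.
by congr measurable; apply/seteqP; split=> w /=; rewrite in_itv/= andbT.
Qed.

Let m_measurable v : measurable_fun setT (fun w => m (v * Y w)).
Proof.
by apply: measurable_minr; apply: measurable_funX; exact: measurable_funM.
Qed.

Let W v : {RV P >-> R} := mfun_Sub (mem_set (m_measurable v)).

Let ccdf_le v s r : 0 < v -> 0 < s -> (forall w, s < m (v * Y w) -> s `^ r < v * Y w) ->
  (ccdf (W v) s <= (G (s `^ r / v))%:E)%E.
Proof.
move=> v0 s0 h; rewrite /G fineK ?fin_num_measure// /ccdf /distribution /pushforward.
apply: le_measure; rewrite ?inE//.
  have := m_measurable v measurableT (measurable_itv `]s, +oo[); rewrite setTI.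
  by [].
move=> w /=; rewrite in_itv/= andbT => /h.
by rewrite ltr_pdivrMr// mulrC.
Qed.

Let powR_scale (v s r a : R) : 0 < v -> 0 < s ->
  (s `^ r / v) `^ (- a) = v `^ a * s `^ (- (a * r)).
Proof.
move=> v0 s0; rewrite powRM ?powR_ge0 ?invr_ge0 ?(ltW v0)// -powRrM mulrN mulrC (mulrC r).
by rewrite -powR_inv1 ?(ltW v0)// -powRrM mulN1r opprK.
Qed.

(** [c1 a] is the integral of s^(-a/(n+1)) over ]0, 1] and [c2 a] that of s^(-a e) over ]1, oo[;
    both converge for p <= a < n + 1. *)
Let c1 (a : R) := (1 - a / n.+1%:R)^-1.

Let c2 (a : R) := (a * e - 1)^-1.

Let lin_int D (A B r1 r2 : R) : measurable D ->
  mu.-integrable D (EFin \o (@powR R ^~ r1)) ->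
  mu.-integrable D (EFin \o (@powR R ^~ r2)) ->
  (\int[mu]_(s in D) (A * s `^ r1 + B * s `^ r2)%:E =
    (A * \int[mu]_(s in D) (s `^ r1) + B * \int[mu]_(s in D) (s `^ r2))%:E)%E.
Proof.
move=> mD i1 i2.
have j1 := @integrableZl_EFin R _ _ mu D A _ mD i1.
have j2 := @integrableZl_EFin R _ _ mu D B _ mD i2.
rewrite -!RintegralZl// -RintegralD//.
rewrite /Rintegral fineK//; apply: integrable_fin_num => //.
apply: (@eq_integrable _ _ _ mu _ _ (fun s => (A * s `^ r1)%:E + (B * s `^ r2)%:E)%E) => //.
exact: integrableD.
Qed.

(** The layer cake integral is cut at level 1: for s <= 1, m(vY) > s forces vY > s^(1/(n+1)), and
    for s > 1 it forces vY > s^e. Two exponents are treated at once because the tail will be bounded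
    by a sum of two powers. *)
Lemma expectation_min_le (A B a b v : R) : 0 <= A -> 0 <= B -> 0 < v ->
  p <= a < n.+1%:R -> p <= b < n.+1%:R ->
  (forall x, 0 < x -> G x <= A * x `^ (- a) + B * x `^ (- b)) ->
  (\int[P]_w (m (v * Y w))%:E <=
    (A * v `^ a * (c1 a + c2 a) + B * v `^ b * (c1 b + c2 b))%:E)%E.
Proof.
move=> A0 B0 v0 /andP[pa an] /andP[pb bn] hG.
have mc D : measurable_fun D (ccdf (W v)).
  by apply: measurable_funTS; exact: ccdf_measurable.
have c0 s : (0 <= ccdf (W v) s)%E by exact: measure_ge0.
have bound r D : (forall s w, D s -> s < m (v * Y w) -> s `^ r < v * Y w) ->
    (forall s, D s -> 0 < s) -> measurable D ->
    (\int[mu]_(s in D) ccdf (W v) s <= \int[mu]_(s in D)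
      (A * v `^ a * s `^ (- (a * r)) + B * v `^ b * s `^ (- (b * r)))%:E)%E.
  move=> h D0 mD; apply: ge0_le_integral => //; first exact: mc.
    apply/measurable_EFinP; apply: measurable_funTS.
    by apply: measurable_funD; apply: measurable_funM => //; exact: measurable_powR.
  move=> s Ds; apply: (le_trans (ccdf_le (r := r) v0 (D0 _ Ds) _)).
    by move=> w; exact: h.
  rewrite lee_fin; apply: (le_trans (hG _ _)).
    by rewrite divr_gt0// powR_gt0// D0.
  have E x := powR_scale r x v0 (D0 _ Ds).
  by rewrite !E !mulrA.
have := ge0_expectation_ccdf (X := W v) (fun w => m_ge0 (mulr_ge0 (ltW v0) (Y0 w))).
rewrite unlock => ->.
rewrite -integral_itv_obnd_cbnd; last exact: mc.
rewrite (@itv0y_split R 1)// ge0_integral_setU//=; [|exact: mc|exact: disj_itv_split].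
have r1 (x : R) : x < n.+1%:R -> -1 < - (x * n.+1%:R^-1).
  by move=> xn; rewrite ltrN2 ltr_pdivrMr// mul1r.
have r2 (x : R) : p <= x -> - (x * e) < -1 by move=> px; rewrite ltrN2 e_gt1.
have h1 := bound n.+1%:R^-1 `](0 : R), 1]%classic _ _ (measurable_itv _).
have h2 := bound e `](1 : R), +oo[%classic _ _ (measurable_itv _).
apply: (le_trans (leeD (h1 _ _) (h2 _ _))).
- move=> s w; rewrite /= in_itv/= => /andP[s0 _] sm; apply: lt_root => //.
    by rewrite mulr_ge0// ltW.
  by move: sm; rewrite /m lt_min => /andP[].
- by move=> s; rewrite /= in_itv/= => /andP[].
- move=> s w; rewrite /= in_itv/= andbT => s1; apply: lt_min_root => //.
  by rewrite mulr_ge0// ltW.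
- by move=> s; rewrite /= in_itv/= andbT; exact: lt_trans.
rewrite !lin_int//; try by [apply: integrable_powR_0c => //; exact: r1|
  apply: integrable_powR_oy => //; exact: r2].
rewrite !Rintegral_powR_0c ?r1// !Rintegral_powR_oy ?r2// !powR1.
rewrite -EFinD lee_fin le_eqVlt; apply/orP; left; apply/eqP.
rewrite /c1 /c2 !mul1r !opprD !opprK (addrC (- _) 1) (addrC (- (b * _)) 1).
by ring.
Qed.

Lemma tail_cvg0_Bker : P.-integrable setT (EFin \o (fun w => Y w ^+ n)) ->
  v `^ (- p) * \int[P]_w Bker n p (v * Y w) @[v --> 0^'+] --> 0 ->
  x `^ p * G x @[x --> +oo] --> 0.
Proof.
move=> iY; set S := fun v : R => _ => S0.
have q0 : 0 < p - n%:R by rewrite subr_gt0.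
have q1 : p - n%:R < 1 by move: pn; rewrite -natr1 => ?; lra.
have [bge0 [c [M [c0 M0 bge]]]] := Bker_sign q0 q1 n.
rewrite addrC subrK in bge0 bge.
(* The scale v = M / x sends the event Y > x into the range vY >= M of the lower bound c, and x^p =
   M^p v^-p. *)
have key x : 0 < x -> x `^ p * G x <= M `^ p / c * `|S (M / x)|.
  move=> x0; have v0 : 0 < M / x by exact: divr_gt0.
  have iB := integrable_Bker np pn mY Y0 iY v0.
  have cG : c * G x <= `|\int[P]_w Bker n p (M / x * Y w)|.
    apply: (@le_trans _ _ ((-1) ^+ n * \int[P]_w Bker n p (M / x * Y w))); last first.
      by rewrite (le_trans (ler_norm _))// normrM normrX normrN1 expr1n mul1r.
    rewrite -RintegralZl//.
    have -> : G x = \int[P]_w \1_[set w | Y w > x] w.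
      by rewrite /Rintegral integral_indic// setIT.
    have i1 : P.-integrable setT (EFin \o (\1_[set w | Y w > x] : T -> R)).
      exact: integrable_indic.
    rewrite -RintegralZl//; apply: le_Rintegral => //.
    - exact: integrableZl_EFin.
    - exact: integrableZl_EFin.
    - move=> w _; rewrite indicE; have [xY|Yx] := ltP x (Y w).
        by rewrite mem_set// mulr1; apply: bge; rewrite mulrAC ler_pdivlMr// ler_pM2l// ltW.
      rewrite memNset/=; last by apply/negP; rewrite -leNgt.
      rewrite mulr0; have := Y0 w; rewrite le_eqVlt => /predU1P[<-|Yw].
        by rewrite mulr0 Bker0 mulr0.
      by apply: bge0; exact: mulr_gt0.
  rewrite /S normrM ger0_norm ?powR_ge0// powRM ?(ltW M0) ?invr_ge0 ?(ltW x0)//.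
  have -> : x^-1 `^ (- p) = x `^ p.
    by rewrite -powR_inv1 ?(ltW x0)// -powRrM mulN1r opprK.
  have ringE (a b c' y z : R) : a / c' * (b * y * z) = (a * b) * (y * (c'^-1 * z)) by ring.
  rewrite ringE -powRD ?(gt_eqF M0) ?implybT// subrr powRr0 mul1r.
  by rewrite ler_wpM2l ?powR_ge0// ler_pdivlMl.
apply/cvgrPdist_lt => eps eps0.
have k0 : 0 < M `^ p / c by rewrite divr_gt0// powR_gt0.
have e0 : 0 < eps / (M `^ p / c) by exact: divr_gt0.
have /cvgrPdist_lt/(_ _ e0)[del /= del0 hdel] := S0.
near=> x.
have x0 : 0 < x by [].
have xd : M / del < x by near: x; apply: nbhs_pinfty_gt; exact: num_real.
rewrite sub0r normrN ger0_norm; last by rewrite mulr_ge0 ?powR_ge0// fine_ge0.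
apply: (le_lt_trans (key _ x0)); rewrite mulrC -ltr_pdivlMr//.
have v0 : 0 < M / x by exact: divr_gt0.
have := hdel (M / x); rewrite /= !sub0r !normrN (gtr0_norm v0); apply => //.
by rewrite ltr_pdivrMr// mulrC -ltr_pdivrMr.
Unshelve. all: by end_near. Qed.

Hypothesis tail0 : (fun x => x `^ p * G x) @ +oo --> 0.

(* The tail is at most eps x^-p + M x^-b for all x > 0, and the second term
   contributes v^b = o(v^p) at scale v. *)
Let b := (p + n.+1%:R) / 2.

Let pb : p < b. Proof. by rewrite /b; move: pn => ?; lra. Qed.

Let bn : b < n.+1%:R. Proof. by rewrite /b; move: pn => ?; lra. Qed.

Let tail_bound eps : 0 < eps -> exists2 M0, 0 <= M0 &
  forall x, 0 < x -> G x <= eps * x `^ (- p) + M0 * x `^ (- b).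
Proof.
move=> eps0; have /cvgrPdist_le/(_ _ eps0)[A [_ hA]] := tail0.
pose A1 := Num.max A 0 + 1.
have A10 : 0 < A1 by rewrite ltr_wpDl// le_max lexx orbT.
have G0 x : 0 <= G x by exact: fine_ge0.
have G1 x : G x <= 1.
  by rewrite /G -lee_fin fineK ?fin_num_measure// probability_le1.
(* For x <= A1 the tail is at most 1, hence at most (A1 / x)^b. *)
exists (A1 `^ b); first exact: powR_ge0.
move=> x x0; have [xA|Ax] := leP x A1.
  apply: (le_trans (G1 x)); apply: ler_wpDl; first by rewrite mulr_ge0 ?powR_ge0 ?(ltW eps0).
  apply: (@le_trans _ _ (x `^ b * x `^ (- b))).
    by rewrite -powRD ?(gt_eqF x0) ?implybT// subrr powRr0.
  rewrite ler_wpM2r ?powR_ge0// ge0_ler_powR ?nnegrE ?(ltW x0) ?(ltW A10)//.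
  exact: ltW (lt_trans p0 pb).
apply: ler_wpDr; first by rewrite mulr_ge0 ?powR_ge0.
have := hA x; rewrite /= sub0r normrN ger0_norm; last by rewrite mulr_ge0 ?powR_ge0.
have -> : A < x.
  by apply: lt_trans Ax; rewrite /A1 ltr_pwDr// le_max lexx.
move=> /(_ isT) h; rewrite powRN ler_pdivlMr ?powR_gt0// mulrC.
exact: h.
Qed.

Let C := 2 / (p - n%:R) + (n.+1%:R - p)^-1.

Let C_gt0 : 0 < C.
Proof. by rewrite addr_gt0// ?divr_gt0 ?invr_gt0 ?subr_gt0. Qed.

(** [K] is fixed before eps, so that eps K v^p is an arbitrarily small multiple of v^p; [M] may
    depend on eps, since v^b is o(v^p). *)
Let min_bound : exists2 K, 0 <= K & forall eps, 0 < eps -> exists2 M, 0 <= M &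
  forall v, 0 < v -> (\int[P]_w (m (v * Y w))%:E <= (eps * K * v `^ p + M * v `^ b)%:E)%E.
Proof.
have K0 x : p <= x -> x < n.+1%:R -> 0 <= c1 x + c2 x.
  move=> px xn; rewrite addr_ge0// invr_ge0 subr_ge0.
    by rewrite ler_pdivrMr// mul1r ltW.
  by rewrite ltW// e_gt1.
exists (c1 p + c2 p); first exact: K0.
move=> eps eps0; have [M M0 hM] := tail_bound eps0.
exists (M * (c1 b + c2 b)); first by rewrite mulr_ge0// K0// ltW.
move=> v v0; have := expectation_min_le (ltW eps0) M0 v0 (a := p) (b := b).
rewrite lexx pn (ltW pb) bn => /(_ isT isT hM).
by move/le_trans; apply; rewrite lee_fin mulrAC (mulrAC M).
Qed.

(** y^n <= 1 + min(y^n, y^(n+1)), as y^n is at most 1 for y <= 1 and is the minimum otherwise; the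
    minimum is integrable by [min_bound] at v = 1. *)
Lemma integrable_expr_tail : P.-integrable setT (EFin \o (fun w => Y w ^+ n)).
Proof.
apply: (@integrable_le_abs R _ _ P _ _ (fun w => 1 + m (1 * Y w))) => //.
- exact: measurable_funX.
- move=> w _; rewrite normrX ger0_norm// mul1r /m; case: (leP (Y w ^+ n) (Y w ^+ n.+1)) => h.
    by rewrite lerDr.
  rewrite exprS in h; have Yn : 0 <= Y w ^+ n by rewrite exprn_ge0.
  have Y1 : Y w <= 1.
    by rewrite leNgt; apply/negP => Y1; move: h; rewrite ltNge ler_peMl// ltW.
  by apply: ler_wpDr; [rewrite exprn_ge0|rewrite exprn_ile1].
have [K _ /(_ _ ltr01)[M _ /(_ _ ltr01) h]] := min_bound.
apply: (@eq_integrable _ _ _ P _ _ (fun w => 1%:E + (m (1 * Y w))%:E)%E) => //.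
apply: integrableD => //.
  exact: (finite_measure_integrable_cst P 1).
apply/integrableP; split; first by apply/measurable_EFinP; exact: m_measurable.
apply: le_lt_trans (ltry (1 * K * 1 `^ p + M * 1 `^ b)).
move: h; congr (_ <= _)%E; apply: eq_integral => w _.
by rewrite gee0_abs// lee_fin m_ge0// mul1r.
Qed.

Let Bker_bound v B : 0 < v -> (\int[P]_w (m (v * Y w))%:E <= B%:E)%E ->
  `|\int[P]_w Bker n p (v * Y w)| <= C * B.
Proof.
move=> v0 h; have i := integrable_Bker np pn mY Y0 integrable_expr_tail v0.
have -> : `|\int[P]_w Bker n p (v * Y w)| =
    fine `|\int[P]_w (Bker n p (v * Y w))%:E|%E by rewrite fine_abse// integrable_fin_num.
rewrite -lee_fin fineK; last by rewrite abse_fin_num integrable_fin_num.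
apply: (le_trans (le_abse_integral _ _ _)) => //; first exact: measurable_int i.
apply: (@le_trans _ _ (\int[P]_w (C%:E * (m (v * Y w))%:E))%E).
  apply: ge0_le_integral => //.
  - by apply: measurableT_comp => //; exact: measurable_int i.
  - by apply/measurable_EFinP; apply: measurable_funM => //; exact: m_measurable.
  - by move=> w _; rewrite lee_fin Bker_norm_le_min// mulr_ge0// ltW.
rewrite ge0_integralZl//.
- by rewrite EFinM lee_pmul2l// lte_fin.
- by apply/measurable_EFinP; exact: m_measurable.
- by move=> w _; rewrite lee_fin m_ge0// mulr_ge0// ltW.
- exact: ltW.
Qed.

Lemma Rintegral_Bker_cvg0 :
  v `^ (- p) * \int[P]_w Bker n p (v * Y w) @[v --> 0^'+] --> 0.
Proof.
have [K K0 hK] := min_bound.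
apply/cvgrPdist_lt => eps eps0.
have CK0 : 0 <= C * K by rewrite mulr_ge0// ltW.
(* Each of C K eta and C M v^(b-p) is to stay within eps / 2; the added 1 keeps the denominators
   positive. *)
pose eta := eps / 2 / (C * K + 1).
have eta0 : 0 < eta by rewrite /eta !divr_gt0// ltr_wpDl.
have [M M0 hM] := hK _ eta0.
have CM0 : 0 <= C * M by rewrite mulr_ge0// ltW.
pose del := eps / 2 / (C * M + 1).
have del0 : 0 < del by rewrite /del !divr_gt0// ltr_wpDl.
have bp : 0 < b - p by rewrite subr_gt0.
near=> v.
have v0 : 0 < v by [].
have vd : v `^ (b - p) <= del.
  have h : v <= del `^ (b - p)^-1 by near: v; apply: nbhs_right_le; exact: powR_gt0.
  apply: (@le_trans _ _ ((del `^ (b - p)^-1) `^ (b - p))).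
    by rewrite ge0_ler_powR ?nnegrE ?powR_ge0 ?(ltW v0) ?(ltW bp).
  by rewrite -powRrM mulVf ?gt_eqF// powRr1 ?(ltW del0).
rewrite sub0r normrN normrM ger0_norm ?powR_ge0//.
apply: (@le_lt_trans _ _ (v `^ (- p) * (C * (eta * K * v `^ p + M * v `^ b)))).
  by rewrite ler_wpM2l ?powR_ge0// Bker_bound// hM.
have E1 : v `^ (- p) * v `^ p = 1 by rewrite -powRD ?(gt_eqF v0) ?implybT// addNr powRr0.
have E2 : v `^ (- p) * v `^ b = v `^ (b - p) by rewrite -powRD ?(gt_eqF v0) ?implybT// addrC.
have ringE (x y z c k l a : R) :
    x * (c * (a * k * y + l * z)) = c * k * a * (x * y) + c * l * (x * z) by ring.
rewrite ringE E1 E2 mulr1 (splitr eps); apply: ltr_leD.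
  by rewrite /eta mulrA ltr_pdivrMr ?ltr_wpDl// mulrC ltr_pM2l ?divr_gt0// ltrDl.
apply: (@le_trans _ _ (C * M * del)); first exact: ler_wpM2l.
by rewrite /del mulrA ler_pdivrMr ?ltr_wpDl// mulrC ler_pM2l ?divr_gt0// lerDl.
Unshelve. all: by end_near. Qed.

End nonneg.

End tail.

(** * The equivalence *)

Theorem theorem2p5 (d : measure_display) (T : measurableType d) (R : realType)
  (P : probability T R) (X : {RV P >-> R}) (p : R) :
  0 < p -> ~ (exists n : nat, p = n%:R) ->
  ('E_P[(fun w => (Num.max (X w) 0) `^ p)%R] < +oo)%E ->
  ( ( ('E_P[(fun w => `|X w| ^+ ell p)%R] < +oo)%E /\
      (forall v : R, 0 < v ->
         lebesgue_measure.-integrable `[v, +oo[ (fun t => (integrand P X p t)%:E)) /\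
      (fun v => Gamma (p + 1) / pi *
                Rintegral lebesgue_measure `[v, +oo[ (integrand P X p))
        @ 0^'+ --> fine 'E_P[(fun w => (Num.max (X w) 0) `^ p)%R] )
    <->
    (fun x : R => x `^ p * fine (P [set w | Num.max (- X w) 0 > x]))
        @ +oo --> 0 ).
Proof.
move=> p0 pN EZ; have [np pn] := ell_itv p0 pN.
have mX : measurable_fun setT X by exact: measurable_funPT.
have mY : measurable_fun setT (fun w => Num.max (- X w) 0).
  by apply: measurable_maxr => //; exact: measurableT_comp.
have mZ : measurable_fun setT (fun w => Num.max (X w) 0) by exact: measurable_maxr.
have Z0 w : 0 <= Num.max (X w) 0 by rewrite le_max lexx orbT.
have iZp : P.-integrable setT (EFin \o (fun w => Num.max (X w) 0 `^ p)).
  apply/integrableP; split.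
    by apply/measurable_EFinP; exact: (measurableT_comp (measurable_powR p) mZ).
  move: EZ; rewrite unlock; congr (_ < _)%E; apply: eq_integral => w _.
  by rewrite gee0_abs// lee_fin powR_ge0.
(* Since ell p < p, the moment of order ell p of X_+ is finite, so that E |X|^(ell p) < oo is a
   condition on X_- alone. *)
have iZn : P.-integrable setT (EFin \o (fun w => Num.max (X w) 0 ^+ ell p)).
  apply: (@integrable_le_abs R _ _ P _ _ (fun w => 1 + Num.max (X w) 0 `^ p)) => //.
  - exact: measurable_funX.
  - move=> w _; rewrite normrX ger0_norm//; have [z1|z1] := leP (Num.max (X w) 0) 1.
      by rewrite ler_wpDr ?powR_ge0// exprn_ile1.
    by rewrite ler_wpDl// -powR_mulrn// ler_powR ?ltW.
  - apply: (@eq_integrable _ _ _ P _ _ (fun w => 1%:E + (Num.max (X w) 0 `^ p)%:E)%E) => //.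
    by apply: integrableD => //; exact: (finite_measure_integrable_cst P 1).
set Y := fun w => Num.max (- X w) 0 in mY *.
have Y0 w : 0 <= Y w by rewrite /Y le_max lexx orbT.
have Xn_split w : `|X w| ^+ ell p <= Num.max (X w) 0 ^+ ell p + Y w ^+ ell p.
  rewrite /Y; have [x0|x0] := leP 0 (X w).
    by rewrite ger0_norm// lerDl; apply: exprn_ge0; exact: Y0.
  by rewrite ltr0_norm// max_l ?oppr_ge0 ?(ltW x0)// lerDr exprn_ge0.
have iX_of_iY : P.-integrable setT (EFin \o (fun w => Y w ^+ ell p)) ->
    P.-integrable setT (EFin \o (fun w => `|X w| ^+ ell p)).
  move=> iY; apply: (@integrable_le_abs R _ _ P _ _
      (fun w => Num.max (X w) 0 ^+ ell p + Y w ^+ ell p)) => //.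
  - by apply: measurable_funX; exact: measurableT_comp.
  - by move=> w _; rewrite ger0_norm ?exprn_ge0.
  - apply: (@eq_integrable _ _ _ P _ _
      (fun w => (Num.max (X w) 0 ^+ ell p)%:E + (Y w ^+ ell p)%:E)%E) => //.
    exact: integrableD.
have iY_of_iX : P.-integrable setT (EFin \o (fun w => `|X w| ^+ ell p)) ->
    P.-integrable setT (EFin \o (fun w => Y w ^+ ell p)).
  move=> iX; apply: (@integrable_le_abs R _ _ P _ _ (fun w => `|X w| ^+ ell p)) => //.
  - exact: measurable_funX.
  - move=> w _; rewrite normrX lerXn2r ?nnegrE// ger0_norm// /Y ge_max normr_ge0 andbT.
    by rewrite -normrN; exact: ler_norm.
have EXE : ('E_P[(fun w => `|X w| ^+ ell p)%R] < +oo)%E <->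
    P.-integrable setT (EFin \o (fun w => `|X w| ^+ ell p)).
  rewrite unlock; split=> [h|/integrable_lty]; last exact.
  apply/integrableP; split.
    by apply/measurable_EFinP; apply: measurable_funX; exact: measurableT_comp.
  move: h; congr (_ < _)%E; apply: eq_integral => w _.
  by rewrite gee0_abs// lee_fin exprn_ge0.
have GP : 0 < Gamma (p + 1) / pi :> R
  by rewrite divr_gt0 ?pi_gt0// (Gamma_gt0 np pn).
set phi := pi * (p + 1) / 2.
have main : Gamma (p + 1) / pi * \int[P]_w (Num.max (X w) 0 `^ p *
      Aint (ell p) p (- phi) (Num.max (X w) 0 * v)) @[v --> 0^'+] -->
    fine 'E_P[(fun w => (Num.max (X w) 0) `^ p)%R].
  rewrite [X in _ --> X](_ : _ = Gamma (p + 1) / pi *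
      (Aint (ell p) p (- phi) 0 * \int[P]_w (Num.max (X w) 0 `^ p))).
    apply: cvgM; first exact: cvg_cst.
    exact: (Rintegral_powR_Aint_cvg np pn mZ Z0 iZn (f := - phi) iZp).
  rewrite mulrA (mulrAC _ pi^-1) (Gamma_Aint_plus np pn) mulfV ?gt_eqF ?pi_gt0// mul1r.
  by rewrite unlock.
pose S v := v `^ (- p) * \int[P]_w Bker (ell p) p (v * Y w).
have intE : P.-integrable setT (EFin \o (fun w => `|X w| ^+ ell p)) -> forall v, 0 < v ->
    Gamma (p + 1) / pi * Rintegral lebesgue_measure `[v, +oo[ (integrand P X p) =
    Gamma (p + 1) / pi * \int[P]_w (Num.max (X w) 0 `^ p *
      Aint (ell p) p (- phi) (Num.max (X w) 0 * v)) + Gamma (p + 1) / pi * S v.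
  move=> iX v v0; have [_ ->] := integrand_integral np pn mX iX (erefl _) v0.
  by rewrite mulrDr.
split=> [[/EXE iX [_ cX]]|tail0].
  apply: (tail_cvg0_Bker np pn mY Y0 (iY_of_iX iX)).
  set l := fine _ in cX main.
  (* The integral and the positive part have the same limit; their difference, freed of the constant
     Gamma(p + 1) / pi, is exactly [S]. *)
  have cS : (Gamma (p + 1) / pi)^-1 *
      (Gamma (p + 1) / pi * Rintegral lebesgue_measure `[v, +oo[ (integrand P X p) -
       Gamma (p + 1) / pi * \int[P]_w (Num.max (X w) 0 `^ p *
         Aint (ell p) p (- phi) (Num.max (X w) 0 * v))) @[v --> 0^'+] --> (0 : R).
    rewrite [X in _ --> X](_ : _ = (Gamma (p + 1) / pi)^-1 * (l - l)); last first.
      by rewrite subrr mulr0.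
    by apply: cvgM; [exact: cvg_cst|exact: cvgB].
  apply: cvg_trans cS; apply: near_eq_cvg; near=> v.
  by rewrite intE// addrAC subrr add0r mulKf ?gt_eqF.
have iY := integrable_expr_tail np pn mY Y0 tail0.
have iX := iX_of_iY iY.
split; first exact/EXE.
split=> [v v0|]; first by have [] := integrand_integral np pn mX iX (erefl _) v0.
have S0 := Rintegral_Bker_cvg0 np pn mY Y0 tail0.
have : Gamma (p + 1) / pi * \int[P]_w (Num.max (X w) 0 `^ p *
      Aint (ell p) p (- phi) (Num.max (X w) 0 * v)) + Gamma (p + 1) / pi * S v @[v --> 0^'+] -->
    fine 'E_P[(fun w => (Num.max (X w) 0) `^ p)%R] + Gamma (p + 1) / pi * 0.
  by apply: cvgD main _; apply: cvgM => //; exact: cvg_cst.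
rewrite mulr0 addr0; apply: cvg_trans; apply: near_eq_cvg; near=> v.
by rewrite intE.
Unshelve. all: by end_near. Qed.
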